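(* Let $a<b$ be real numbers, $1<\alpha\le2$, $0\le\beta\le1$, let $q:[a,b]\to\mathbb{R}$ be continuous, and let $l,m,n,p\ge0$ satisfy $mn+lp+l\,n\,(b-a)>0$. If the boundary value problem $$\left(D^{\alpha,\beta}_{a}y\right)(t)+q(t)y(t)=0,\quad a<t<b,$$ $$l\left(I_{a}^{(2-\alpha)(1-\beta)}y\right)(a)-m\left(DI_{a}^{(2-\alpha)(1-\beta)}y\right)(a)=0,$$ $$n\left(I_{a}^{(2-\alpha)(1-\beta)}y\right)(b)+p\left(DI_{a}^{(2-\alpha)(1-\beta)}y\right)(b)=0$$ has a nontrivial solution, then $$\int_a^b(s-a)^{(\alpha-2)(1-\beta)}(b-s)^{\beta(\alpha-2)}|q(s)|\,ds\ge\frac1\Lambda,$$ where $$\Lambda=\max\left\{\Omega,\frac{b-a}{\Gamma(\alpha)}\right\},\qquad \Omega=\frac{\left[l(b-a)+m(\alpha-1+\beta(2-\alpha))\right]\left[n(b-a)+p(1-2\beta+\alpha\beta)\right]}{\left[mn+lp+l\,n\,(b-a)\right]\Gamma(2-2\beta+\alpha\beta)\,\Gamma(2-(2-\alpha)(1-\beta))}.$$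
   Context: For $\mu>0$ the Riemann--Liouville fractional integral is $(I_a^{\mu}y)(t)=\frac{1}{\Gamma(\mu)}\int_a^t(t-s)^{\mu-1}y(s)\,ds$ for $t>a$, and $I_a^0$ is the identity. $D$ is the first order differential operator. For $1<\alpha\le2$, $0\le\beta\le1$, the Hilfer fractional derivative of order $\alpha$ and type $\beta$ is $(D_a^{\alpha,\beta}y)(t)=\left(I_a^{\beta(2-\alpha)}D^2I_a^{(2-\alpha)(1-\beta)}y\right)(t)$, $t>a$, where $D^2=d^2/dt^2$. $AC^2[a,b]$ is the space of continuously differentiable real functions on $[a,b]$ whose first derivative is absolutely continuous on $[a,b]$. With $\gamma=(2-\alpha)(1-\beta)\in[0,1)$, $C_\gamma[a,b]$ is the space of functions $y:(a,b]\to\mathbb{R}$ such that $(t-a)^\gamma y(t)$ (extended to $t=a$ by its limit) is continuous on $[a,b]$. A solution of the boundary value problem is a function $y\in C_\gamma[a,b]$ such that $I_a^{\gamma}y$ (extended to $t=a$ by its limit) belongs to $AC^2[a,b]$, the differential equation holds for almost every $t\in(a,b)$ (with $D^2I_a^\gamma y$ the almost everywhere defined second derivative), and the boundary conditions hold; values of $I_a^\gamma y$ and $DI_a^\gamma y$ at $a$ and $b$ are those of the $C^1$ function $I_a^\gamma y$ and its derivative. A solution is nontrivial if it is not identically zero. *)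

(* Defs.v *)
From HB Require Import structures.
From mathcomp Require Import all_boot all_order all_algebra.
From mathcomp Require Import all_classical all_reals all_analysis.

Set Implicit Arguments.
Unset Strict Implicit.
Unset Printing Implicit Defensive.

Import Order.TTheory GRing.Theory Num.Theory.
Import numFieldNormedType.Exports.

Local Open Scope classical_set_scope.
Local Open Scope ring_scope.

(* Euler's integral: the Gamma function for x > 0 only. *)
Definition Gamma (R : realType) (x : R) : R :=
  \int[@lebesgue_measure R]_(t in `]0, +oo[) (t `^ (x - 1) * expR (- t)).

(* Meaningful for mu >= 0 and t > a; only the values of y on ]a, t] matter. *)
Definition RLint (R : realType) (a mu : R) (y : R -> R) (t : R) : R :=
  if mu == 0 then y t
  else (Gamma mu)^-1 *
       \int[@lebesgue_measure R]_(s in `]a, t[) ((t - s) `^ (mu - 1) * y s).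

(* For a < t < b the derivatives are only taken at points of ]a, t], hence
   they are ordinary two-sided derivatives there and do not depend on the
   values of y outside ]a, b[.  At the points where the second derivative
   does not exist, derive1n has a default value. *)
Definition hilfer (R : realType) (a alpha beta : R) (y : R -> R) : R -> R :=
  RLint a (beta * (2 - alpha))
    (derive1n 2 (RLint a ((2 - alpha) * (1 - beta)) y)).

Definition extend_left (R : realType) (a : R) (f : R -> R) (t : R) : R :=
  if t == a then lim (f x @[x --> a^'+]) else f t.

(* Difference quotients are restricted to `[a, b], so that the derivatives
   at a and b are one-sided. *)
Definition derivable_on (R : realType) (a b : R) (f : R -> R) (x : R) : Prop :=
  cvg ((f s - f x) / (s - x) @[s --> within `[a, b] x^']).

Definition derive_on (R : realType) (a b : R) (f : R -> R) (x : R) : R :=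
  lim ((f s - f x) / (s - x) @[s --> within `[a, b] x^']).

Definition abs_continuous (R : realType) (a b : R) (f : R -> R) : Prop :=
  forall e : R, 0 < e -> exists2 d : R, 0 < d &
    forall (N : nat) (u v : 'I_N -> R),
      (forall i, a <= u i /\ u i <= v i /\ v i <= b) ->
      trivIset [set: 'I_N] (fun i => `]u i, v i[%classic) ->
      \sum_(i < N) (v i - u i) < d ->
      \sum_(i < N) `|f (v i) - f (u i)| < e.

Definition AC2 (R : realType) (a b : R) (f : R -> R) : Prop :=
  [/\ forall x, x \in `[a, b] -> derivable_on a b f x,
      {within `[a, b], continuous (derive_on a b f)} &
      abs_continuous a b (derive_on a b f)].

(* If the limit at a does not exist, the continuity at a fails whatever the
   value given there by extend_left. *)
Definition C_weighted (R : realType) (a b gamma : R) (y : R -> R) : Prop :=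
  {within `[a, b], continuous
    (extend_left a (fun t => (t - a) `^ gamma * y t))}.

(* A function ]a, b] -> R is represented by a total function y, whose values
   outside ]a, b] are irrelevant. *)
Definition hilfer_bvp_solution (R : realType) (a b alpha beta : R)
    (q : R -> R) (l m n p : R) (y : R -> R) : Prop :=
  let gamma := (2 - alpha) * (1 - beta) in
  let v := extend_left a (RLint a gamma y) in
  [/\ C_weighted a b gamma y,
      AC2 a b v,
      {ae @lebesgue_measure R, forall t, a < t < b ->
        hilfer a alpha beta y t + q t * y t = 0},
      l * v a - m * derive_on a b v a = 0 &
      n * v b + p * derive_on a b v b = 0].

(* Main.v *)
Require Import Defs.
From HB Require Import structures.
From mathcomp Require Import all_boot all_order all_algebra.
From mathcomp Require Import all_classical all_reals all_analysis.
From mathcomp Require Import measurable_realfun ring lra.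

Set Implicit Arguments.
Unset Strict Implicit.
Unset Printing Implicit Defensive.

Import Order.TTheory GRing.Theory Num.Theory.
Import numFieldNormedType.Exports.

Local Open Scope classical_set_scope.
Local Open Scope ring_scope.

(** Put gamma = (2 - alpha)(1 - beta) and delta = beta (2 - alpha), so that
    gamma + delta = 2 - alpha, and let v = I^gamma y with v' its derivative.
    The proof is Lyapunov's: write the solution through a Green function,
    bound the Green function by its sup, and evaluate at a maximum point.

    Every fractional integral is a convolution with the kernel
    k_mu(u) = u^(mu - 1) / Gamma(mu) for u > 0 ([fker], [conv]), and the
    Beta integral, obtained from Tonelli's theorem, gives the semigroup law
    k_mu * k_nu = k_(mu + nu) ([fker_conv], [conv_semigroup]).  Since v' is
    absolutely continuous it is the integral of an integrable function phi,
    which equals v'' almost everywhere ([ac_ftc]).  That theorem comes from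
    the variation function of v', the Lebesgue-Stieltjes measures of the two
    monotone functions it yields, the Radon-Nikodym theorem and Lebesgue
    differentiation.

    The differential equation now says k_delta * phi = h with h = - q y, and
    v is c0 k_1 + c1 k_2 (both shifted to a) plus k_2 * phi, where
    c0 = v(a) and c1 = v'(a).  Convolving with k_(1 - gamma) turns v into
    k_1 * y, and phi enters through k_(3 - gamma) * phi
    = k_1 * k_alpha * k_delta * phi = k_1 * k_alpha * h.  Differentiating
    once gives, almost everywhere,
      y = c0 k_(1 - gamma) + c1 k_(2 - gamma) + k_alpha * h
    ([integral_equation]).  In the same way the values of v and v' at b are
    expressed through h ([boundary_v], [boundary_w]); the boundary conditions
    then determine c0 and c1, and (t - a)^gamma y(t) becomes the integral of
    green(t, s) h(s) ([green_representation]).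

    The function green is a difference of two nonnegative terms, so its
    absolute value is at most the larger one; the first is at most
    (b - a)/Gamma(alpha) (b - s)^(- delta) and the second at most
    Omega (b - s)^(- delta) ([green_bound]).  Let M > 0 be the maximum of
    (t - a)^gamma |y(t)| and J the integral of the theorem.  Then
    (t - a)^gamma |y(t)| <= Lambda M J for almost every t, hence, by
    continuity, for every t; at a maximum point this is 1 <= Lambda J. *)

(** * Affine changes of variable for Lebesgue measure *)

Section ChangeOfVariable.
Context {R : realType}.
Notation mu := (@lebesgue_measure R).
Local Open Scope ereal_scope.

(** A measure on the Borel sets is Lebesgue measure as soon as it agrees with
    it on half-open intervals; here the measure is the image under the
    reflection. *)
Lemma ge0_integral_reflect (f : R -> \bar R) (d : R) :
  measurable_fun [set: R] f -> (forall x, 0 <= f x) ->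
  \int[mu]_x f (d - x)%R = \int[mu]_x f x.
Proof.
move=> mf f0.
have mphi : measurable_fun setT ((fun x => d - x)%R : R -> measurableTypeR R).
  by apply: measurable_funB.
transitivity (\int[pushforward mu ((fun x => d - x)%R : R -> measurableTypeR R)]_x f x).
  by rewrite ge0_integral_pushforward// => x _; apply: measurable_funTS.
apply: eq_measure_integral => A mA _.
apply/esym; apply: lebesgue_measure_unique => //= _ [[a b]] _ <-.
rewrite /pushforward /=.
rewrite (_ : _ @^-1` _ = `[d - b, d - a[%classic)%R; last first.
  by apply/seteqP; split => x /=; rewrite !in_itv/= => /andP[? ?]; apply/andP; split; lra.
rewrite !lebesgue_measure_itv/= !lte_fin.
have -> : (d - b < d - a)%R = (a < b)%R by lra.
by case: ifP => // _; rewrite -!EFinB; congr EFin; lra.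
Qed.

Lemma ge0_integral_scale (f : R -> \bar R) (c : R) : (0 < c)%R ->
  measurable_fun [set: R] f -> (forall x, 0 <= f x) ->
  c%:E * \int[mu]_x f (c * x)%R = \int[mu]_x f x.
Proof.
move=> c0 mf f0.
have mphi : measurable_fun setT ((fun x => c * x)%R : R -> measurableTypeR R).
  by apply: measurable_funM.
have -> : \int[mu]_x f (c * x)%R =
   \int[pushforward mu ((fun x => c * x)%R : R -> measurableTypeR R)]_x f x.
  by rewrite ge0_integral_pushforward// => x _; apply: measurable_funTS.
rewrite -[c]/((NngNum (ltW c0))%:num)%R -ge0_integral_mscale//.
apply: eq_measure_integral => A mA _.
apply/esym; apply: lebesgue_measure_unique => //= _ [[a b]] _ <-.
rewrite /mscale/= /pushforward /=.
rewrite (_ : _ @^-1` _ = `]a / c, b / c]%classic)%R; last first.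
  apply/seteqP; split => x /=; rewrite !in_itv/=;
    by rewrite ltr_pdivrMr// ler_pdivlMr// mulrC.
rewrite !lebesgue_measure_itv/= !lte_fin ltr_pM2r ?invr_gt0//.
case: ifP => // _; last by rewrite mule0.
by rewrite -!EFinB -EFinM; congr EFin; field; rewrite gt_eqF.
Qed.

End ChangeOfVariable.

(** * Integrals of powers *)

Section PowerIntegral.
Context {R : realType}.
Notation mu := (@lebesgue_measure R).

Lemma powR_pderivable (p x : R) : 0 < x -> derivable (@powR R ^~ p) x 1.
Proof. by move=> x0; apply: derivable_powR; rewrite in_itv/= x0. Qed.

Lemma powR_pcontinuous (p x : R) : 0 < x -> {for x, continuous (@powR R ^~ p)}.
Proof.
move=> x0; apply: (@differentiable_continuous _ R^o R^o).
exact/derivable1_diffP/powR_pderivable.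
Qed.

Lemma powR_within (p e t : R) : 0 < e -> {within `[e, t], continuous (@powR R ^~ p)}.
Proof.
move=> e0; apply: continuous_in_subspaceT => x /set_mem/=.
rewrite in_itv/= => /andP[ex _]; apply: powR_pcontinuous.
exact: lt_le_trans ex.
Qed.

Lemma integral_powR_cc (m e t : R) : 0 < m -> 0 < e -> e < t ->
  (\int[mu]_(x in `[e, t]) (x `^ (m - 1))%:E = (t `^ m / m - e `^ m / m)%:E)%E.
Proof.
move=> m0 e0 et.
rewrite (@continuous_FTC2 _ _ (fun x => x `^ m / m))//.
- exact: powR_within.
- have D (x : R) : 0 < x -> derivable (fun x : R => x `^ m / m) x 1.
    by move=> x0; apply: derivableM => //; exact: powR_pderivable.
  have C (x : R) : 0 < x -> (fun x : R => x `^ m / m) x0 @[x0 --> x] --> x `^ m / m.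
    by move=> x0; apply: cvgM; [exact: powR_pcontinuous|exact: cvg_cst].
  split.
  + move=> x; rewrite in_itv/= => /andP[ex _]; apply: D; exact: lt_trans ex.
  + by apply: cvg_at_right_filter; exact: C.
  + by apply: cvg_at_left_filter; apply: C; exact: lt_trans et.
- move=> x; rewrite in_itv/= => /andP[ex _].
  have x0 : 0 < x by exact: lt_trans ex.
  rewrite derive1Mr; last exact: powR_pderivable.
  rewrite powR_derive1 ?in_itv/= ?x0// [m * _]mulrC mulfK ?gt_eqF//.
Qed.

(** For m < 1 the integrand is unbounded at 0, so the fundamental theorem of
    calculus is applied away from 0 and the limit is monotone convergence. *)
Lemma integral_powR (m t : R) : 0 < m -> 0 < t ->
  (\int[mu]_(x in `]0%R, t[) (x `^ (m - 1))%:E = (t `^ m / m)%:E)%E.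
Proof.
move=> m0 t0.
have mp : measurable_fun [set: R] (EFin \o (fun x : R => x `^ (m - 1))).
  by apply/measurable_EFinP; exact: measurable_powR.
rewrite integral_itv_bndo_bndc; last exact: measurable_funTS.
(* n.+2 keeps the interval nondegenerate for n = 0 *)
pose F n := `[t / n.+2%:R, t]%classic : set R.
have FE : \bigcup_n F n = `]0, t]%classic.
  apply/seteqP; split => x /=.
    move=> [n _]; rewrite /F /= !in_itv/= => /andP[a ->]; rewrite andbT.
    by apply: lt_le_trans a; rewrite divr_gt0.
  rewrite in_itv/= => /andP[x0 xt].
  have [n Hn] : exists n : nat, t / x < n%:R.
    exists (Num.bound (t / x)); apply: archi_boundP.
    by rewrite divr_ge0// ltW.
  exists n => //; rewrite /F/= in_itv/= xt andbT.
  rewrite ler_pdivrMr// mulrC -ler_pdivrMr// (le_trans (ltW Hn))// ler_nat.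
  by rewrite -addn2 leq_addr.
rewrite -FE.
have ndF : nondecreasing_seq F.
  apply/nondecreasing_seqP => n; apply/subsetPset => x; rewrite /F/= !in_itv/=.
  move=> /andP[a ->]; rewrite andbT; apply: le_trans a.
  by rewrite ler_pM2l// lef_pV2 ?posrE// ler_nat.
have H : (\int[mu]_(x in F i) (x `^ (m - 1))%:E @[i --> \oo] -->
    \int[mu]_(x in \bigcup_i F i) (x `^ (m - 1))%:E)%E.
  apply: ge0_nondecreasing_set_cvg_integral => //.
  - by move=> i; exact: measurable_itv.
  - by move=> i; apply: measurable_funTS.
  - by move=> *; rewrite lee_fin powR_ge0.
suff H2 : (\int[mu]_(x in F i) (x `^ (m - 1))%:E @[i --> \oo] -->
    (t `^ m / m)%:E)%E by exact: (cvg_unique _ H H2).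
rewrite [X in X @ _ --> _](_ : _ = (fun n => (t `^ m / m - (t / n.+2%:R) `^ m / m)%:E)); last first.
  apply/funext => n; rewrite /F integral_powR_cc ?divr_gt0//.
  by rewrite ltr_pdivrMr// ltr_pMr// ltr1n.
apply: cvg_EFin; first by near=> n.
rewrite -[X in _ --> X]subr0; apply: cvgB; first exact: cvg_cst.
rewrite -[X in _ --> X](mul0r m^-1); apply: cvgM; last exact: cvg_cst.
have c0 := @powR_cvg0 R m m0.
apply: (cvg_at_rightP _ _ _).1 c0 _ _ => //.
split; first by move=> n; rewrite divr_gt0.
rewrite -[X in _ --> X](mulr0 t); apply: cvgM; first exact: cvg_cst.
have := @cvg_harmonic R; rewrite -(@cvg_shiftS R^o (@harmonic R))/=; exact.
Unshelve. all: by end_near. Qed.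

End PowerIntegral.

(** * The Gamma function and the Beta integral *)

Section TruncatedPower.
Context {R : realType}.
Notation mu := (@lebesgue_measure R).

Definition tpow (m u : R) : R := if 0 < u then u `^ (m - 1) else 0.

Lemma tpow_ge0 (m u : R) : 0 <= tpow m u.
Proof. by rewrite /tpow; case: ifP => // _; exact: powR_ge0. Qed.

Lemma tpowE (m u : R) : 0 < u -> tpow m u = u `^ (m - 1).
Proof. by rewrite /tpow => ->. Qed.

Lemma tpow_le0 (m u : R) : u <= 0 -> tpow m u = 0.
Proof. by rewrite /tpow leNgt => /negbTE ->. Qed.

Lemma measurable_tpow (m : R) : measurable_fun [set: R] (tpow m).
Proof.
apply: measurable_fun_ifT; [|exact: measurable_powR|exact: measurable_cst].
by apply: measurable_fun_ltr.
Qed.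

(** The Gamma integral with values in the extended reals: the identities below
    hold before finiteness is known, and finiteness is deduced from them. *)
Definition eGamma (m : R) : \bar R := (\int[mu]_t (tpow m t * expR (- t))%:E)%E.

(** At t = 1 this is Euler's Beta integral; a general t makes it a
    convolution, which is the form produced by a double Gamma integral. *)
Definition eBeta (m n t : R) : \bar R :=
  (\int[mu]_s (tpow m (t - s) * tpow n s)%:E)%E.

Lemma GammaE (m : R) : Gamma m = fine (eGamma m).
Proof.
rewrite /Gamma /Rintegral /eGamma integral_mkcond; congr fine.
apply: eq_integral => t _; rewrite patchE /tpow.
case: ifPn => [/set_mem/=|/negP/=]; first by rewrite in_itv/= andbT => ->.
by rewrite inE/= in_itv/= andbT => /negP/negbTE ->; rewrite mul0r.
Qed.

Lemma measurable_tpowB (m t : R) : measurable_fun [set: R] (fun s => tpow m (t - s)).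
Proof.
apply: measurableT_comp; first exact: measurable_tpow.
exact: measurable_funB.
Qed.

Lemma measurable_tpow_conv (m n t : R) :
  measurable_fun [set: R] (fun s => (tpow m (t - s) * tpow n s)%:E).
Proof.
apply/measurable_EFinP; apply: measurable_funM; last exact: measurable_tpow.
exact: measurable_tpowB.
Qed.

Lemma eBeta_ge0 (m n t : R) : (0%R <= eBeta m n t)%E.
Proof. by apply: integral_ge0 => s _; rewrite lee_fin mulr_ge0// tpow_ge0. Qed.

(** Homogeneity: substitute s -> t s. *)
Lemma eBeta_scale (m n t : R) : eBeta m n t = ((tpow (m + n) t)%:E * eBeta m n 1)%E.
Proof.
have [t0|t0] := leP t 0.
  rewrite tpow_le0// mul0e; apply: integral0_eq => s _.
  have [s0|s0] := leP s 0; first by rewrite (tpow_le0 n s0) mulr0.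
  by rewrite tpow_le0 ?mul0r// subr_le0 (le_trans t0)// ltW.
rewrite /eBeta -(ge0_integral_scale t0); last 2 first.
- exact: measurable_tpow_conv.
- by move=> s; rewrite lee_fin mulr_ge0// tpow_ge0.
rewrite (tpowE _ t0).
under eq_integral => s _.
  rewrite (_ : tpow m (t - t * s) * tpow n (t * s) =
    t `^ (m - 1) * t `^ (n - 1) * (tpow m (1 - s) * tpow n s)); last first.
    rewrite -[X in X - _](mulr1 t) -mulrBr /tpow !pmulr_rgt0//.
    case: ifPn => s1; last by rewrite !(mul0r, mulr0).
    case: ifPn => s2; last by rewrite !(mul0r, mulr0).
    by rewrite !powRM ?ltW//; ring.
  rewrite EFinM; over.
rewrite ge0_integralZl//=; last 3 first.
- exact: measurable_tpow_conv.
- by move=> s _; rewrite lee_fin mulr_ge0// tpow_ge0.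
- by rewrite lee_fin mulr_ge0// ?powR_ge0.
rewrite muleA -EFinM; congr (_%:E * _)%E.
rewrite -powRD; last by rewrite (gt_eqF t0) implybT.
rewrite -[X in X * _](powRr1 (ltW t0)) -powRD; last by rewrite (gt_eqF t0) implybT.
by congr powR; ring.
Qed.

Lemma eGamma_ge0 (m : R) : (0%R <= eGamma m)%E.
Proof. by apply: integral_ge0 => s _; rewrite lee_fin mulr_ge0// ?tpow_ge0// expR_ge0. Qed.

Lemma ge0_integral_translate (f : R -> \bar R) (d : R) :
  measurable_fun [set: R] f -> (forall x, 0%R <= f x)%E ->
  (\int[mu]_x f (x - d)%R = \int[mu]_x f x)%E.
Proof.
move=> mf f0.
rewrite -[RHS](ge0_integral_reflect 0)//.
rewrite -(ge0_integral_reflect d (f := fun x => f (0 - x)))//.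
  by apply: eq_integral => x _; rewrite sub0r opprB.
by apply: (measurableT_comp mf); exact: measurable_funB.
Qed.

Lemma measurable_tpow_exp (m : R) :
  measurable_fun [set: R] (fun t => (tpow m t * expR (- t))%:E).
Proof.
apply/measurable_EFinP; apply: measurable_funM; first exact: measurable_tpow.
by apply: measurableT_comp => //; exact: measurableT_comp.
Qed.

(** Tonelli's theorem for the function (x, y) -> (x - y)^(m-1) y^(n-1) exp(-x):
    integrating first in y gives a Beta convolution at x, integrating first in
    x gives, after a translation, a product of two Gamma integrals. *)
Lemma eGammaM (m n : R) : (eGamma m * eGamma n = eBeta m n 1 * eGamma (m + n))%E.
Proof.
pose f (z : R * R) := (tpow m (z.1 - z.2) * tpow n z.2 * expR (- z.1))%:E.
have mf : measurable_fun [set: R * R] f.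
  apply/measurable_EFinP; apply: measurable_funM.
    apply: measurable_funM.
      apply: measurableT_comp; first exact: measurable_tpow.
      exact: measurable_funB.
    exact: (measurableT_comp (measurable_tpow n) measurable_snd).
  by apply: measurableT_comp => //; exact: measurableT_comp.
have f0 z : (0%R <= f z)%E.
  by rewrite lee_fin !mulr_ge0// ?tpow_ge0// expR_ge0.
have := @fubini_tonelli _ _ (measurableTypeR R) (measurableTypeR R) R mu mu f mf f0.
rewrite /f /=.
under eq_integral => x _.
  under eq_integral => y _ do rewrite mulrC EFinM.
  rewrite ge0_integralZl; [|exact: measurableT|exact: measurable_tpow_conv|
    by move=> s _; rewrite lee_fin mulr_ge0// tpow_ge0|by rewrite lee_fin expR_ge0].
  rewrite -/(eBeta m n x) eBeta_scale muleCA muleA muleC -EFinM.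
  over.
rewrite ge0_integralZl; [|exact: measurableT|exact: measurable_tpow_exp|
  by move=> s _; rewrite lee_fin mulr_ge0 ?tpow_ge0 ?expR_ge0|exact: eBeta_ge0].
rewrite -/(eGamma (m + n)) => ->.
under eq_integral => y _.
  rewrite (_ : (fun x => _) = (fun x => (tpow n y * expR (- y))%:E * (tpow m (x - y) * expR (- (x - y)))%:E))%E; last first.
    apply/funext => x; rewrite -EFinM; congr EFin.
    rewrite (_ : - x = - y + - (x - y)); last by ring.
    by rewrite expRD; ring.
  rewrite ge0_integralZl; [|exact: measurableT|
    by apply: (measurableT_comp (measurable_tpow_exp m)); exact: measurable_funB|
    by move=> s _; rewrite lee_fin mulr_ge0// ?tpow_ge0// expR_ge0|
    by rewrite lee_fin mulr_ge0// ?tpow_ge0// expR_ge0].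
  rewrite (ge0_integral_translate (f := fun z => (tpow m z * expR (- z))%:E));
    [|exact: measurable_tpow_exp|
    by move=> s; rewrite lee_fin mulr_ge0// ?tpow_ge0// expR_ge0].
  rewrite -/(eGamma m) muleC.
  over.
rewrite ge0_integralZl//; [exact: measurable_tpow_exp| |exact: eGamma_ge0].
by move=> s _; rewrite lee_fin mulr_ge0// ?tpow_ge0// expR_ge0.
Qed.

End TruncatedPower.

Section GammaFunction.
Context {R : realType}.
Notation mu := (@lebesgue_measure R).

Lemma integral_tpow (m t : R) : 0 < m -> 0 < t ->
  (\int[mu]_(s in `]-oo, t[) (tpow m s)%:E = (t `^ m / m)%:E)%E.
Proof.
move=> m0 t0; rewrite -(integral_powR m0 t0) [LHS]integral_mkcond [RHS]integral_mkcond.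
apply: eq_integral => s _; rewrite !patchE !mem_setE !in_itv/= /tpow.
by case: (0 < s); case: (s < t).
Qed.

Lemma eBetam1 (m : R) : 0 < m -> eBeta m 1 1 = (m^-1)%:E.
Proof.
move=> m0; have := integral_tpow m0 ltr01; rewrite powR1 mul1r => <-.
rewrite integral_mkcond -(ge0_integral_reflect 1).
- apply: eq_integral => s _; rewrite patchE mem_setE in_itv/= ltrBlDl ltrDr.
  rewrite [tpow 1 s]/tpow; case: ifP => _; last by rewrite mulr0.
  by rewrite subrr powRr0 mulr1.
- apply/(measurable_restrictT _ _).1 => //.
  by apply: measurable_funTS; apply/measurable_EFinP; exact: measurable_tpow.
- by move=> s; rewrite patchE; case: ifP => // _; rewrite lee_fin tpow_ge0.
Qed.

Lemma eGamma1 : eGamma (1 : R) = 1%E.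
Proof.
rewrite -(integral_exponential_pdf (@ltr01 R)).
transitivity (\int[mu]_(x in `[0%R, +oo[) (expR (- x))%:E)%E; last first.
  rewrite integral_mkcond; apply: eq_integral => x _.
  rewrite /exponential_pdf !patchE; case: ifP => // _.
  by rewrite /= mulN1r mul1r.
rewrite -integral_itv_obnd_cbnd; last first.
  apply: measurable_funTS; apply/measurable_EFinP.
  by apply: measurableT_comp => //; exact: measurableT_comp.
rewrite integral_mkcond; apply: eq_integral => s _.
rewrite patchE mem_setE in_itv/= andbT /tpow; case: ifP => _; last by rewrite mul0r.
by rewrite subrr powRr0 mul1r.
Qed.

Lemma eGammaS (m : R) : 0 < m -> eGamma (m + 1) = (m%:E * eGamma m)%E.
Proof.
move=> m0; have := eGammaM m 1; rewrite eGamma1 mule1 eBetam1// => ->.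
by rewrite muleA -EFinM divff ?mul1e// gt_eqF.
Qed.

Lemma eGamma_gt0 (m : R) : 0 < m -> (0 < eGamma m)%E.
Proof.
move=> m0; apply: (@lt_le_trans _ _ ((expR (-1))%:E * (m^-1)%:E)%E).
  by rewrite mule_gt0// lte_fin ?expR_gt0// invr_gt0.
have := integral_tpow m0 ltr01; rewrite powR1 mul1r => <-.
have mt : measurable_fun [set: R] (EFin \o tpow m).
  by apply/measurable_EFinP; exact: measurable_tpow.
rewrite -ge0_integralZl; [|exact: measurable_itv|exact: measurable_funTS|
  by move=> *; rewrite lee_fin tpow_ge0|by rewrite lee_fin expR_ge0].
rewrite integral_mkcond; apply: ge0_le_integral => //.
- move=> s _; rewrite patchE; case: ifP => // _.
  by rewrite mule_ge0 ?lee_fin ?expR_ge0 ?tpow_ge0.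
- apply/(measurable_restrictT _ _).1 => //.
  apply: measurable_funTS; apply: emeasurable_funM => //.
- exact: measurable_tpow_exp.
- move=> s _; rewrite patchE mem_setE in_itv/=; case: ifPn => s1; last first.
    by rewrite lee_fin mulr_ge0 ?expR_ge0 ?tpow_ge0.
  rewrite lee_fin mulrC ler_wpM2l ?tpow_ge0// ler_expR lerN2; exact: ltW.
Qed.

(** The values at integers bound all the others, in [eGamma_lty]. *)
Lemma eGamma_nat (n : nat) : (eGamma (n.+1%:R : R) < +oo)%E.
Proof.
elim: n => [|n ih]; first by rewrite eGamma1 ltry.
rewrite -natr1 eGammaS// lte_mul_pinfty//.
Qed.

(** Below 1 the integrand is at most t^(m-1); above 1 it is at most the
    integrand of the Gamma integral at an integer exceeding m. *)
Lemma eGamma_lty (m : R) : 0 < m -> (eGamma m < +oo)%E.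
Proof.
move=> m0.
(* n.+1 - 1 = n dominates the exponent m - 1 *)
pose n := Num.bound m.
have mn : m < n%:R by apply: archi_boundP; exact: ltW.
pose f := (EFin \o tpow m) \_ (`]-oo, 1[ : set R).
have mt : measurable_fun [set: R] (EFin \o tpow m).
  by apply/measurable_EFinP; exact: measurable_tpow.
have mf : measurable_fun [set: R] f.
  by apply/(measurable_restrictT _ _).1 => //; exact: measurable_funTS.
have f0 s : (0%R <= f s)%E.
  by rewrite /f patchE; case: ifP => // _; rewrite lee_fin tpow_ge0.
apply: (@le_lt_trans _ _ (\int[mu]_s (f s + (tpow n.+1%:R s * expR (- s))%:E))%E).
  apply: ge0_le_integral => //.
  - by move=> s _; rewrite lee_fin mulr_ge0 ?expR_ge0 ?tpow_ge0.
  - exact: measurable_tpow_exp.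
  - by apply: emeasurable_funD => //; exact: measurable_tpow_exp.
  move=> s _; have [s0|s0] := leP s 0.
    by rewrite tpow_le0// mul0r adde_ge0// lee_fin mulr_ge0 ?expR_ge0 ?tpow_ge0.
  rewrite /f patchE mem_setE in_itv/=; case: ltP => s1.
    rewrite -[leLHS]adde0; apply: leeD; last first.
      by rewrite lee_fin mulr_ge0 ?expR_ge0 ?tpow_ge0.
    rewrite lee_fin -[leRHS]mulr1 ler_wpM2l ?tpow_ge0//.
    by rewrite -expR0 ler_expR oppr_le0 ltW.
  rewrite add0e lee_fin ler_wpM2r ?expR_ge0// !(tpowE _ s0).
  apply: ler_powR => //; rewrite -natr1; lra.
rewrite ge0_integralD//; last 2 first.
- by move=> s _; rewrite lee_fin mulr_ge0 ?expR_ge0 ?tpow_ge0.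
- exact: measurable_tpow_exp.
rewrite lte_add_pinfty ?eGamma_nat//.
by rewrite /f -integral_mkcond (integral_tpow m0 ltr01) ltry.
Qed.

Lemma eGammaE (m : R) : 0 < m -> eGamma m = (Gamma m)%:E.
Proof. by move=> m0; rewrite GammaE fineK// ge0_fin_numE ?eGamma_lty// ltW ?eGamma_gt0. Qed.

Lemma Gamma_gt0 (m : R) : 0 < m -> 0 < Gamma m.
Proof. by move=> m0; rewrite -lte_fin -eGammaE// eGamma_gt0. Qed.

Lemma Gamma1 : Gamma (1 : R) = 1.
Proof. by rewrite GammaE eGamma1. Qed.

Lemma GammaS (m : R) : 0 < m -> Gamma (m + 1) = m * Gamma m.
Proof. by move=> m0; apply: EFin_inj; rewrite EFinM -!eGammaE ?addr_gt0// eGammaS. Qed.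

(** The kernel of the Riemann-Liouville integral of order m, extended by 0 to
    the left so that fractional integrals are convolutions on the line. *)
Definition fker (m u : R) : R := tpow m u / Gamma m.

Lemma fker_ge0 (m u : R) : 0 < m -> 0 <= fker m u.
Proof. by move=> m0; rewrite divr_ge0 ?tpow_ge0// ltW// Gamma_gt0. Qed.

Lemma fker_le0 (m u : R) : u <= 0 -> fker m u = 0.
Proof. by move=> u0; rewrite /fker tpow_le0// mul0r. Qed.

Lemma measurable_fker (m : R) : measurable_fun [set: R] (fker m).
Proof. by apply: measurable_funM => //; exact: measurable_tpow. Qed.

(** The normalisation by Gamma is chosen for this: the constants on both sides
    are compared through [eGammaM]. *)
Lemma fker_conv0 (m n t : R) : 0 < m -> 0 < n ->
  (\int[mu]_s (fker m (t - s) * fker n s)%:E = (fker (m + n) t)%:E)%E.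
Proof.
move=> m0 n0.
transitivity (((Gamma m)^-1 * (Gamma n)^-1)%:E * eBeta m n t)%E.
  rewrite -ge0_integralZl//.
  - apply: eq_integral => s _; rewrite -EFinM /fker mulf_div -invfM.
  by congr EFin; exact: mulrC.
  - exact: measurable_tpow_conv.
  - by move=> s _; rewrite lee_fin mulr_ge0 ?tpow_ge0.
  - by rewrite lee_fin mulr_ge0// invr_ge0 ltW// Gamma_gt0.
rewrite eBeta_scale; have := eGammaM m n; rewrite !eGammaE ?addr_gt0//.
have := eBeta_ge0 m n (1 : R).
have Gm := Gamma_gt0 m0; have Gn := Gamma_gt0 n0; have Gmn := Gamma_gt0 (addr_gt0 m0 n0).
case: (eBeta m n 1) => [B| |] // _; last by rewrite gt0_mulye ?lte_fin.
rewrite -!EFinM => -[E]; congr EFin; rewrite /fker.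
rewrite mulrCA; congr (_ * _); move: E Gm Gn Gmn.
move: (Gamma m) (Gamma n) (Gamma (m + n)) => G1 G2 G3 E G10 G20 G30.
apply: (mulIf (lt0r_neq0 G30)); rewrite -mulrA -E mulVf ?gt_eqF//.
by rewrite -invfM mulVf// mulf_neq0 ?gt_eqF.
Qed.

Lemma fker_conv (m n t u : R) : 0 < m -> 0 < n ->
  (\int[mu]_s (fker m (t - s) * fker n (s - u))%:E = (fker (m + n) (t - u))%:E)%E.
Proof.
move=> m0 n0; rewrite -(fker_conv0 (t - u) m0 n0).
rewrite -(ge0_integral_translate (f := fun s => (fker m (t - u - s) * fker n s)%:E) u).
- by apply: eq_integral => s _; congr (fker _ _ * _)%:E; ring.
- apply/measurable_EFinP; apply: measurable_funM; last exact: measurable_fker.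
  by apply: (measurableT_comp (measurable_fker m)); exact: measurable_funB.
- by move=> s; rewrite lee_fin mulr_ge0 ?fker_ge0.
Qed.

End GammaFunction.

(** * Integrals of almost everywhere equal functions *)

Section AeEqualIntegral.
Context d (T : measurableType d) (R : realType).
Variable nu : {measure set T -> \bar R}.
Local Open Scope ereal_scope.
Import HBNNSimple.

(** The functions are arbitrary, measurable or not: a second derivative which
    exists only almost everywhere, with a default value elsewhere, has to be
    replaced by an integrable function under the integral sign.  The integral
    of a nonnegative function is a supremum over simple functions below it,
    and a simple function keeps its integral when it is set to 0 on a null
    set. *)
Lemma ge0_ae_le_integral_any (f g : T -> \bar R) (N : set T) :
  measurable N -> nu N = 0 -> (forall x, 0 <= f x) -> (forall x, 0 <= g x) ->
  (forall x, ~ N x -> f x = g x) -> \int[nu]_x f x <= \int[nu]_x g x.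
Proof.
move=> mN N0 f0 g0 fg; rewrite (ge0_integralTE _ f0) (ge0_integralTE _ g0).
apply: ge_ereal_sup => _ [h /= hf <-].
have mCN := measurableC mN.
pose h' := proj_nnsfun h mCN.
have h'E x : h' x = (h x * (x \in ~` N)%:R)%R by rewrite /h'/= mindicE.
apply: ereal_sup_ubound; exists h' => /=.
  move=> x; change ((h' x)%:E <= g x); rewrite h'E; have [xN|xN] := pselect (N x).
    by rewrite memNset ?mulr0// => /(_ xN).
  by rewrite mem_set// mulr1 -fg.
rewrite -!integralT_nnsfun; apply: ge0_ae_eq_integral => //.
- by apply/measurable_EFinP; exact: measurable_funPT.
- by apply/measurable_EFinP; exact: measurable_funPT.
- by move=> x _; rewrite lee_fin.
- by move=> x _; rewrite lee_fin.
exists N; split => // x /=; apply: contra_notP => xN _.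
change ((h' x)%:E = (h x)%:E); rewrite h'E mem_set// mulr1 //.
Qed.

Lemma ae_eq_integral_any (f g : T -> \bar R) :
  {ae nu, forall x, f x = g x} -> \int[nu]_x f x = \int[nu]_x g x.
Proof.
move=> [N [mN N0 fg]].
have E x : ~ N x -> f x = g x by apply: contra_notP => ?; exact: fg.
rewrite [LHS]integralE [RHS]integralE; congr (_ - _); apply/eqP; rewrite eq_le;
  apply/andP; split; apply: (@ge0_ae_le_integral_any _ _ N) => // x Nx;
  by rewrite ?funeposE ?funenegE E.
Qed.

Lemma ae_eq_Rintegral_any (f g : T -> R) :
  {ae nu, forall x, f x = g x} -> (\int[nu]_x f x = \int[nu]_x g x)%R.
Proof.
move=> fg; congr fine; apply: ae_eq_integral_any.
by apply: filterS fg => x ->.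
Qed.

End AeEqualIntegral.

Section Measurability.
Context d (T : measurableType d) (R : realType).
Variable nu : {measure set T -> \bar R}.

(** Linearity without integrability, for a fractional integral which is only
    known to converge at almost every point: when the integral is not finite
    both sides are 0. *)
Lemma Rintegral_scale_gt0 (f : T -> R) (c : R) : 0 < c ->
  measurable_fun setT f ->
  \int[nu]_x (c * f x) = c * \int[nu]_x f x.
Proof.
move=> c0 mf; rewrite /Rintegral.
suff -> : (\int[nu]_x (c * f x)%:E = c%:E * \int[nu]_x (f x)%:E)%E.
  by case: (\int[nu]_x (f x)%:E)%E => [r| |]//=; rewrite ?gt0_mulye ?gt0_muleNy ?gt0_muley ?lte_fin//= mulr0.
rewrite integralE [X in (_ * X)%E]integralE.
have -> : (fun x => (c * f x)%:E)^\+%E = (fun x => c%:E * (EFin \o f)^\+%E x)%E.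
  by rewrite -(ge0_funeposM _ (ltW c0)).
have -> : (fun x => (c * f x)%:E)^\-%E = (fun x => c%:E * (EFin \o f)^\-%E x)%E.
  by rewrite -(ge0_funenegM _ (ltW c0)).
have mfE : measurable_fun setT (EFin \o f) by exact/measurable_EFinP.
rewrite !ge0_integralZl_EFin//; last 4 first.
- exact: measurable_funeneg.
- exact: ltW.
- exact: measurable_funepos.
- exact: ltW.
have : (0 <= \int[nu]_x (EFin \o f)^\+%E x)%E by apply: integral_ge0.
have : (0 <= \int[nu]_x (EFin \o f)^\-%E x)%E by apply: integral_ge0.
case: integral => [a| |]//; case: integral => [e| |]// _ _;
 rewrite ?gt0_muley ?gt0_muleNy ?lte_fin//= ?gt0_muley ?gt0_muleNy ?lte_fin//.
by rewrite -!(EFinD, EFinM) mulrDr mulrN.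
Qed.

End Measurability.

(** * Fractional integrals as convolutions *)

Section Convolution.
Context {R : realType}.
Notation mu := (@lebesgue_measure R).

Definition conv (m : R) (f : R -> R) (t : R) : R :=
  \int[mu]_s (fker m (t - s) * f s).

(** Holds without integrability, since both parts of the integrand are covered
    by Tonelli's theorem. *)
Lemma measurable_Rint2 (g : R * R -> R) : measurable_fun [set: R * R] g ->
  measurable_fun [set: R] (fun s => \int[mu]_u g (s, u)).
Proof.
move=> mg.
have mgE : measurable_fun [set: R * R] (EFin \o g) by exact/measurable_EFinP.
apply: (measurableT_comp (@fine_measurable R setT measurableT)).
under eq_fun do rewrite integralE.
apply: emeasurable_funB.
- rewrite (_ : (fun s => _) = fubini_F mu ((EFin \o g)^\+%E)); last first.
    by apply/funext => s; apply: eq_integral => u _; rewrite !funeposE.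
  apply: measurable_fun_fubini_tonelli_F; first exact: measurable_funepos.
  by move=> z; exact: funepos_ge0.
- rewrite (_ : (fun s => _) = fubini_F mu ((EFin \o g)^\-%E)); last first.
    by apply/funext => s; apply: eq_integral => u _; rewrite !funenegE.
  apply: measurable_fun_fubini_tonelli_F; first exact: measurable_funeneg.
  by move=> z; exact: funeneg_ge0.
Qed.

Lemma measurable_fkerB (m t : R) : measurable_fun [set: R] (fun s => fker m (t - s)).
Proof.
by apply: (measurableT_comp (measurable_fker m)); exact: measurable_funB.
Qed.

Lemma measurable_conv (m : R) f : measurable_fun [set: R] f ->
  measurable_fun [set: R] (conv m f).
Proof.
move=> mf; apply: (@measurable_Rint2 (fun z => fker m (z.1 - z.2) * f z.2)).
apply: measurable_funM; last exact: (measurableT_comp mf measurable_snd).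
by apply: (measurableT_comp (measurable_fker m)); exact: measurable_funB.
Qed.

Notation L1 := (mu.-integrable [set: R]).

(** Fubini's theorem and [fker_conv].  The hypothesis is the integrability of
    the absolute values of the iterated kernel, in closed form.  The inner
    integral may fail to exist at some s, but only on a null set. *)
Lemma conv_semigroup (m n : R) (f : R -> R) (t : R) : 0 < m -> 0 < n ->
  measurable_fun [set: R] f ->
  L1 (fun u => (fker (m + n) (t - u) * f u)%:E) ->
  L1 (fun s => (fker m (t - s) * conv n f s)%:E) /\
  conv m (conv n f) t = conv (m + n) f t.
Proof.
move=> m0 n0 mf intf.
pose g (z : R * R) := fker m (t - z.1) * fker n (z.1 - z.2) * f z.2.
have mg : measurable_fun [set: R * R] g.
  apply: measurable_funM; last exact: (measurableT_comp mf measurable_snd).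
  apply: measurable_funM.
    exact: (measurableT_comp (measurable_fkerB m t) measurable_fst).
  by apply: (measurableT_comp (measurable_fker n)); exact: measurable_funB.
have mgE : measurable_fun [set: R * R] (EFin \o g) by exact/measurable_EFinP.
have mc : measurable_fun [set: R] (fun s => fker m (t - s) * conv n f s).
  by apply: measurable_funM; [exact: measurable_fkerB|exact: measurable_conv].
have inner u : (\int[mu]_s (g (s, u))%:E = (fker (m + n) (t - u) * f u)%:E)%E.
  under eq_integral do rewrite /g/= mulrC EFinM.
  rewrite integralZl; first by rewrite fker_conv// -EFinM mulrC.
  - exact: measurableT.
  - apply/integrableP; split.
      apply/measurable_EFinP; apply: measurable_funM; first exact: measurable_fkerB.
      by apply: (measurableT_comp (measurable_fker n)); exact: measurable_funB.
    rewrite (eq_integral (fun s : measurableTypeR R => (fker m (t - s) * fker n (s - u))%:E)); last first.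
      by move=> s _; rewrite gee0_abs// lee_fin mulr_ge0 ?fker_ge0.
    by rewrite fker_conv// ltry.
have ig : (mu \x mu)%E.-integrable [set: R * R] (EFin \o g).
  apply/(@integrable21ltyP _ _ (measurableTypeR R) (measurableTypeR R) R mu mu _ mgE).
  move/integrableP : intf => [_]; apply: le_lt_trans.
  rewrite le_eqVlt; apply/orP; left; apply/eqP; apply: eq_integral => u _ /=.
  transitivity (`|f u|%:E * \int[mu]_s (fker m (t - s) * fker n (s - u))%:E)%E; last first.
    by rewrite fker_conv// -EFinM normrM (ger0_norm (fker_ge0 _ _)) ?addr_gt0// mulrC.
  rewrite -ge0_integralZl.
  - apply: eq_integral => s _; rewrite /g/= normrM -EFinM mulrC.
    by rewrite (ger0_norm (mulr_ge0 (fker_ge0 _ m0) (fker_ge0 _ n0))).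
  - exact: measurableT.
  - apply/measurable_EFinP; apply: measurable_funM; first exact: measurable_fkerB.
    by apply: (measurableT_comp (measurable_fker n)); exact: measurable_funB.
  - by move=> s _; rewrite lee_fin mulr_ge0 ?fker_ge0.
  - by rewrite lee_fin.
(* Where the kernel in s vanishes nothing has to be integrable; elsewhere
   divide by it. *)
have aeE : {ae mu, forall s, (\int[mu]_u (g (s, u))%:E = (fker m (t - s) * conv n f s)%:E)%E}.
  have := @ae_integrable1 _ _ (measurableTypeR R) (measurableTypeR R) R mu mu (EFin \o g) ig.
  apply: filterS => s /= ints.
  have [k0|k0] := eqVneq (fker m (t - s)) 0.
    by rewrite k0 mul0r; apply: integral0_eq => u _; rewrite /g/= k0 !mul0r.
  have ih : L1 (fun u => (fker n (s - u) * f u)%:E).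
    have := @integrableZl _ _ R mu setT (measurableT) (fker m (t - s))^-1 _ ints.
    apply: eq_integrable => // u _ /=.
    rewrite /g /= -EFinM; congr EFin; rewrite -[X in _ * X]mulrA.
    exact: mulKf k0 _.
  rewrite /conv EFinM /Rintegral fineK; last exact: integrable_fin_num.
  rewrite -integralZl//; apply: eq_integral => u _.
  rewrite -EFinM; congr EFin; rewrite /g/=; apply/esym; exact: mulrA.
have iF := @integrable_fubini_F _ _ (measurableTypeR R) (measurableTypeR R) R mu mu (EFin \o g) ig.
split.
  apply/integrableP; split; first exact/measurable_EFinP.
  move/integrableP : iF => [mF]; rewrite -(@ae_eq_integral_any _ _ _ mu (fun s : measurableTypeR R => `|(fker m (t - s) * conv n f s)%:E|%E))//.
  by apply: (@filterS _ _ (ae_filter_ringOfSetsType mu) _ _ _ aeE) => s <-.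
rewrite [LHS]/conv [RHS]/conv /Rintegral; congr fine.
rewrite -(@ae_eq_integral_any _ _ _ mu _ _ aeE).
under [RHS]eq_integral do rewrite -inner.
exact: (@Fubini _ _ (measurableTypeR R) (measurableTypeR R) R mu mu (EFin \o g) ig).
Qed.

End Convolution.

(** * Absolute continuity and total variation *)

Section AbsoluteContinuity.
Context {R : realType}.
Variables a b : R.
Implicit Types (f g w : R -> R) (L : seq (R * R)) (e d : R).

(** An interval is a pair whose first component is its right end: this is the
    shape in which [variation_zip] lists the steps of a subdivision. *)
Definition encloses (x : R) (I : R * R) : bool := I.2 < x < I.1.

(** Disjointness of the open intervals, expressed by counting: unlike a
    condition on pairs of indices it does not see the order of the list and is
    stable under the subdivision of one of the intervals. *)
Definition nonoverlapping L :=
  all (fun I => (a <= I.2) && (I.2 <= I.1) && (I.1 <= b)) L /\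
  forall x, (count (encloses x) L <= 1)%N.

Definition total_length L : R := \sum_(I <- L) (I.1 - I.2).

Definition oscillation f L : R := \sum_(I <- L) `|f I.1 - f I.2|.

Definition ac_modulus f e d := forall L, nonoverlapping L -> total_length L < d ->
  oscillation f L <= e.

Lemma abs_continuousP f : abs_continuous a b f ->
  forall e, 0 < e -> exists2 d, 0 < d & ac_modulus f e d.
Proof.
move=> acf e e0; have [d d0 H] := acf e e0; exists d => // L [Lab Lc] Ld.
pose z := (a, a) : R * R.
have := H (size L) (fun i => (nth z L i).2) (fun i => (nth z L i).1).
move=> K; apply/ltW; rewrite /oscillation (big_nth z) big_mkord; apply: K.
- move=> i; have := all_nthP z Lab i (ltn_ord i).
  by move=> /andP[/andP[-> ->] ->].
- move=> i j _ _ [x [/=]]; rewrite !in_itv/= => xi xj.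
  apply/eqP/contraT => ij; have := Lc x; rewrite leqNgt => /negP; case.
  rewrite -sum1_count (big_nth z) big_mkord.
  by rewrite (bigD1 i)//= (bigD1 j)//= /encloses ?xi ?xj ?[j == i]eq_sym.
- by move: Ld; rewrite /total_length (big_nth z) big_mkord.
Qed.

Definition steps u s : seq (R * R) := zip s (u :: s).

Lemma stepsE u s v : itv_partition u v s ->
  [/\ all (fun I => (u <= I.2) && (I.2 <= I.1) && (I.1 <= v)) (steps u s),
      forall x, (count (encloses x) (steps u s) <= (u < x < v)%R)%N &
      total_length (steps u s) = v - u].
Proof.
elim: s u => [|c s ih] u.
  move=> [_ /= /eqP ->]; split => //; rewrite /total_length/steps/= ?big_nil ?subrr//.
move=> [/= /andP[uc cs] lc]; have [i1 i2 i3] := ih c (conj cs lc).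
have cv : c <= v.
  exact: (itv_partition_le (conj cs lc)).
split.
- rewrite /steps/= lexx (ltW uc) cv/=; apply/allP => I /(allP i1).
  by move=> /andP[/andP[h1 ->] ->]; rewrite (le_trans (ltW uc) h1).
- move=> x; have := i2 x; rewrite /steps/= [encloses _ (c, u)]/encloses/=.
  have [cx|xc] /= := ltP c x.
    by rewrite (lt_trans uc cx) [x < c]ltNge (ltW cx).
  rewrite leqn0 => /eqP ->; rewrite addn0.
  case: (u < x) => //=; case: (ltP x c) => //= xc'.
  by rewrite (lt_le_trans xc' cv).
- rewrite /total_length /steps/= big_cons/=.
  by rewrite -/(steps c s) -/(total_length (steps c s)) i3; ring.
Qed.

Lemma nonoverlapping_perm L1 L2 : perm_eq L1 L2 -> nonoverlapping L1 -> nonoverlapping L2.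
Proof.
move=> L12 [h1 h2]; split; first by rewrite -(perm_all _ L12).
by move=> x; rewrite -(permP L12).
Qed.

Lemma nonoverlapping_refine v u L s : itv_partition u v s ->
  nonoverlapping ((v, u) :: L) -> nonoverlapping (steps u s ++ L).
Proof.
move=> /stepsE[s1 s2 s3] [/= /andP[/andP[/andP[au uv] vb] aL] h2]; split.
  rewrite all_cat aL andbT; apply/allP => I /(allP s1)/andP[/andP[h3 ->] h4].
  by rewrite (le_trans au h3) (le_trans h4 vb).
move=> x; apply: leq_trans (h2 x); rewrite count_cat leq_add2r.
exact: s2.
Qed.

(** Replacing the oscillation on some of the intervals by the total variation
    does not change the bound.  Induction on the list: an interval is replaced
    by the steps of a subdivision, which join the intervals measured by
    oscillation, and then the supremum over subdivisions is taken. *)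
Lemma ac_modulus_TV f e d : ac_modulus f e d -> forall L1 L2,
  nonoverlapping (L1 ++ L2) -> total_length (L1 ++ L2) < d ->
  ((\sum_(I <- L1) total_variation I.2 I.1 f) + (oscillation f L2)%:E <= e%:E)%E.
Proof.
move=> fed; elim => [|[v u] L1 ih] L2 nL Ld.
  by rewrite big_nil add0e lee_fin; exact: fed.
have /andP[/andP[au uv] vb] : (a <= u) && (u <= v) && (v <= b).
  by case: nL => /= /andP[].
have key s : itv_partition u v s ->
    ((\sum_(I <- L1) total_variation I.2 I.1 f)
     + (variation u v f s + oscillation f L2)%:E <= e%:E)%E.
  move=> us.
  have p : perm_eq (steps u s ++ L1 ++ L2) (L1 ++ (steps u s ++ L2)).
    by rewrite perm_catCA.
  have := ih (steps u s ++ L2); rewrite [oscillation f (_ ++ _)]/oscillation big_cat/=.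
  rewrite (variation_zip _ us); apply.
    by apply: (nonoverlapping_perm p); exact: nonoverlapping_refine nL.
  move: Ld; rewrite /total_length -(perm_big _ p)/= !big_cat !big_cons big_cat/=.
  by have [_ _] := stepsE us; rewrite /total_length => ->.
rewrite big_cons/=.
have S0 : (0%R <= \sum_(I <- L1) total_variation I.2 I.1 f)%E.
  rewrite big_seq; apply: sume_ge0 => I IL; apply: total_variation_ge0.
  case: nL => /= /andP[_ + _]; rewrite all_cat => /andP[/allP/(_ _ IL)].
  by move=> /andP[/andP[]].
move: uv; rewrite le_eqVlt => /predU1P[uv|uv].
  subst v; rewrite total_variationxx add0e.
  have := key [::]; rewrite /variation big_geq// add0r; apply.
  by split => /=.
move: S0 key; case: (\sum_(I <- L1) _)%E => [S| |] // S0 key; last first.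
  by have := key _ (itv_partition1 uv).
rewrite -addeA -EFinD -leeBrDr//.
apply: ge_ereal_sup => _ [_ [s us <-] <-].
rewrite leeBrDr// -EFinD addrC -addrA [_ + variation _ _ _ _]addrC EFinD.
by have := key s us; rewrite -EFinD.
Qed.

End AbsoluteContinuity.

Section JordanDecomposition.
Context {R : realType}.
Variables a b : R.
Hypothesis ab : a <= b.

Definition ac_on (f : R -> R) :=
  forall e, 0 < e -> exists2 d, 0 < d & ac_modulus a b f e d.

Lemma nonoverlapping1 (u v : R) : a <= u -> u <= v -> v <= b -> nonoverlapping a b [:: (v, u)].
Proof.
move=> au uv vb; split; first by rewrite /= au uv vb.
by move=> x /=; rewrite addn0 leq_b1.
Qed.

(** Intervals shorter than the modulus for 1 have variation at most 1, and
    finitely many of them reach t. *)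
Lemma ac_TV_lty (f : R -> R) : ac_on f ->
  forall t, a <= t <= b -> (total_variation a t f < +oo)%E.
Proof.
move=> acf; have [d d0 H] := acf _ ltr01.
have small u v : a <= u -> u <= v -> v <= b -> v - u < d ->
    (total_variation u v f <= 1%:E)%E.
  move=> au uv vb uvd.
  have := @ac_modulus_TV R a b f 1 d H [:: (v, u)] [::].
  rewrite cats0 big_seq1 /oscillation big_nil adde0; apply.
    exact: nonoverlapping1.
  by rewrite /total_length big_seq1.
have K k t : a <= t <= b -> t <= a + k%:R * (d / 2) -> (total_variation a t f < +oo)%E.
  elim: k t => [|k ih] t /andP[at_ tb].
    rewrite mul0r addr0 => ta.
    have -> : t = a by apply/eqP; rewrite eq_le ta at_.
    by rewrite total_variationxx.
  move=> tk; pose c := Num.max a (t - d / 2).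
  have d2 : 0 < d / 2 by rewrite divr_gt0.
  have ac : a <= c by rewrite /c le_max lexx.
  have ct : c <= t by rewrite /c ge_max at_/= lerBlDr lerDl ltW.
  rewrite (@total_variationD _ a t c)// lte_add_pinfty//.
    apply: ih; first by rewrite ac (le_trans ct tb).
    rewrite /c ge_max; apply/andP; split; first by rewrite lerDl mulr_ge0// ltW.
    by move: tk; rewrite -natr1 mulrDl mul1r => tk; lra.
  apply: le_lt_trans (ltry 1); apply: small => //.
  have : t - d / 2 <= c by rewrite le_max lexx orbT.
  by move=> ?; lra.
move=> t atb; apply: (K (Num.bound ((t - a) / (d / 2)))) => //.
rewrite -lerBlDl -ler_pdivrMr ?divr_gt0//; apply/ltW/archi_boundP.
case/andP: atb => at_ _; apply: divr_ge0; first by rewrite subr_ge0.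
by rewrite divr_ge0// ltW.
Qed.

Definition tv (f : R -> R) (t : R) : R := fine (total_variation a t f).

Lemma tvB (f : R -> R) (u v : R) : ac_on f -> a <= u -> u <= v -> v <= b ->
  (tv f v - tv f u)%:E = total_variation u v f.
Proof.
move=> acf au uv vb; rewrite /tv.
have fin t : a <= t -> t <= b -> total_variation a t f \is a fin_num.
  by move=> at_ tb; rewrite ge0_fin_numE ?total_variation_ge0// ac_TV_lty// at_ tb.
rewrite EFinB !fineK ?fin// ?(le_trans au uv)// ?(le_trans uv vb)//.
by rewrite (total_variationD f au uv) addeAC subee ?add0e// fin// (le_trans uv).
Qed.

Lemma tv_ge (f : R -> R) (u v : R) : ac_on f -> a <= u -> u <= v -> v <= b ->
  `|f v - f u| <= tv f v - tv f u.
Proof.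
by move=> acf au uv vb; rewrite -lee_fin tvB//; exact: total_variation_ge.
Qed.

Lemma tv_ac (f : R -> R) : ac_on f -> ac_on (tv f).
Proof.
move=> acf e e0; have [d d0 H] := acf e e0; exists d => // L nL Ld.
have := @ac_modulus_TV R a b f e d H L [::]; rewrite cats0 => /(_ nL Ld).
rewrite [oscillation f _]/oscillation big_nil adde0 -lee_fin; apply: le_trans.
rewrite /oscillation -sumEFin big_seq [leRHS]big_seq.
apply: lee_sum => I IL; case: nL => /allP/(_ _ IL)/andP[/andP[h1 h2] h3] _.
rewrite -tvB// lee_fin ger0_norm// (le_trans _ (tv_ge acf h1 h2 h3))//.
Qed.

Lemma ac_onB (f g : R -> R) : ac_on f -> ac_on g -> ac_on (fun t => f t - g t).
Proof.
move=> acf acg e e0; have e2 : 0 < e / 2 by rewrite divr_gt0.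
have [d1 d10 H1] := acf _ e2; have [d2 d20 H2] := acg _ e2.
exists (Num.min d1 d2); first by rewrite lt_min d10.
move=> L nL; rewrite lt_min => /andP[L1 L2].
rewrite [e]splitr; apply: le_trans (lerD (H1 _ nL L1) (H2 _ nL L2)).
rewrite /oscillation -big_split/=; apply: ler_sum => I _.
rewrite (_ : _ - _ = (f I.1 - f I.2) - (g I.1 - g I.2)); last by ring.
exact: ler_normB.
Qed.

Definition nd_on (f : R -> R) := forall u v, a <= u -> u <= v -> v <= b -> f u <= f v.

Lemma tv_nd (f : R -> R) : ac_on f -> nd_on (tv f).
Proof.
by move=> acf u v au uv vb; rewrite -subr_ge0 (le_trans _ (tv_ge acf au uv vb)).
Qed.

(** With [tv_nd] this writes f as a difference of nondecreasing functions;
    [tv_ac] and [ac_onB] say that they are absolutely continuous as well. *)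
Lemma tvB_nd (f : R -> R) : ac_on f -> nd_on (fun t => tv f t - f t).
Proof.
move=> acf u v au uv vb; have := tv_ge acf au uv vb.
by move=> /(le_trans (ler_norm _)) h; lra.
Qed.

End JordanDecomposition.

(** * The derivative of an absolutely continuous function *)

Section MonotoneDensity.
Context {R : realType}.
Notation mu := (@lebesgue_measure R).
Variables (a b : R) (g : R -> R).
Hypothesis ab : a <= b.
Hypothesis ndg : nd_on a b g.
Hypothesis acg : ac_on a b g.

(** A measure on the whole line needs a function on the whole line: extend g by
    its end values. *)
Let clamp (x : R) := Num.max a (Num.min x b).

Let clampP (x : R) : a <= clamp x <= b.
Proof. by rewrite /clamp le_max lexx/= ge_max ab ge_min lexx orbT. Qed.

Let clamp_id (x : R) : a <= x <= b -> clamp x = x.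
Proof. by move=> /andP[ax xb]; rewrite /clamp (min_idPl xb) (max_idPr ax). Qed.

Let clamp_le (x y : R) : x <= y -> clamp x <= clamp y.
Proof. by move=> xy; rewrite /clamp; apply: le_max2 => //; exact: le_min2. Qed.

Let clamp_lip (x y : R) : x <= y -> clamp y - clamp x <= y - x.
Proof. by rewrite /clamp /Num.max /Num.min => xy; do ![case: ifP] => *; lra. Qed.

Let G (x : R) := g (clamp x).

Let G_nd : nondecreasing G.
Proof.
move=> x y xy; rewrite /G; have /andP[h1 h2] := clampP x; have /andP[h3 h4] := clampP y.
by apply: ndg => //; exact: clamp_le.
Qed.

Let G_unif e : 0 < e -> exists2 d, 0 < d & forall x y, x <= y -> y - x < d ->
  G y - G x <= e.
Proof.
move=> e0; have [d d0 H] := acg e0; exists d => // x y xy yxd.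
have := H [:: (clamp y, clamp x)]; rewrite /total_length /oscillation !big_seq1/=.
move=> K; apply: le_trans (ler_norm _) _; apply: K.
  have /andP[h1 h2] := clampP x; have /andP[h3 h4] := clampP y.
  by apply: nonoverlapping1 => //; exact: clamp_le.
exact: le_lt_trans (clamp_lip xy) yxd.
Qed.

Let G_continuous : continuous G.
Proof.
move=> x; apply/cvgrPdist_le => /= e e0; have [d d0 H] := G_unif e0.
near=> y; have [xy|yx] := leP x y.
  rewrite distrC ger0_norm ?subr_ge0 ?G_nd//; apply: H => //.
  near: y; exists d => //= y /=; rewrite distrC => h; exact: le_lt_trans (ler_norm _) h.
have yx' := ltW yx; rewrite ger0_norm ?subr_ge0 ?G_nd//; apply: H => //.
by near: y; exists d => //= y /= h; exact: le_lt_trans (ler_norm _) h.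
Unshelve. all: by end_near. Qed.

Let Gc : cumulative R R :=
  HB.pack G (isCumulative.Build R _ R G G_nd (right_continuousW G_continuous)).

Let muG : {measure set (measurableTypeR R) -> \bar R} := lebesgue_stieltjes_measure Gc.

Let muG_oc (u v : R) : u <= v -> muG `]u, v]%classic = (G v - G u)%:E.
Proof.
move=> uv; rewrite /muG /= /lebesgue_stieltjes_measure /measure_extension.
rewrite measurable_mu_extE; last exact: is_ocitv.
by rewrite /= wlength_itv_bnd.
Qed.

(** Points have measure 0, by continuity of G. *)
Let muG_cc (u v : R) : u <= v -> (muG `[u, v]%classic <= (G v - G u)%:E)%E.
Proof.
move=> uv; apply/lee_addgt0Pr => e e0; have [d d0 H] := G_unif e0.
have d2 : 0 < d / 2 by rewrite divr_gt0.
have u' : u - d / 2 <= u by rewrite lerBlDr lerDl ltW.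
apply: (@le_trans _ _ (muG `]u - d / 2, v]%classic)).
  apply: le_measure; rewrite ?inE//.
  by move=> x /=; rewrite !in_itv/= => /andP[ux ->]; rewrite andbT; lra.
rewrite muG_oc ?(le_trans u')// -EFinD lee_fin.
have := H _ _ u'; rewrite opprB addrC subrK => /(_ _) K.
have : G u - G (u - d / 2) <= e by apply: K; lra.
by move=> ?; lra.
Qed.

Let muG_fin : (muG `]a, b]%classic < +oo)%E.
Proof. by rewrite muG_oc// ltry. Qed.

Let nu : {finite_measure set (measurableTypeR R) -> \bar R} :=
  @mfrestr _ (measurableTypeR R) R _ muG (measurable_itv `]a, b]) muG_fin.

Let nuE A : nu A = muG (A `&` `]a, b]%classic). Proof. by []. Qed.

(** Since nu lives on (a, b], an arbitrary interval may be replaced by one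
    with end points in [a, b], to which absolute continuity applies. *)
Let nu_interval (I : set R) : is_interval I -> measurable I ->
  exists J : R * R, [/\ a <= J.2, J.2 <= J.1, J.1 <= b,
    forall x, encloses x J -> I x &
    (nu I <= (g J.1 - g J.2)%:E)%E].
Proof.
move=> iI mI; pose J := I `&` `]a, b]%classic.
have [J0|/set0P[z Jz]] := eqVneq J set0.
  exists (a, a); split => //=; first by move=> x /andP[/lt_trans h /h]; rewrite ltxx.
  by rewrite nuE -/J J0 measure0 subrr.
have lJ : lbound J a by move=> x [_ /=]; rewrite in_itv/= => /andP[/ltW].
have uJ : ubound J b by move=> x [_ /=]; rewrite in_itv/= => /andP[].
have hi : has_inf J by split; [exists z|exists a].
have hs : has_sup J by split; [exists z|exists b].
have ai : a <= inf J by apply: lb_le_inf => //; exists z.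
have sb : sup J <= b by apply: ge_sup => //; exists z.
have is_ : inf J <= sup J.
  by apply: (@le_trans _ _ z); [apply: ge_inf => //; case: hi|apply: ub_le_sup => //; case: hs].
exists (sup J, inf J); split => //=.
  move=> x /andP[/= ix xs].
  have [y Jy yx] := inf_lt hi.1 ix; have [y' Jy' xy'] := sup_gt hs.1 xs.
  case: Jy => Iy _; case: Jy' => Iy' _.
  by apply: (iI y y') => //; rewrite (ltW yx) (ltW xy').
rewrite nuE -/J; apply: (@le_trans _ _ (muG `[inf J, sup J]%classic)).
  apply: le_measure; rewrite ?inE//; first exact: measurableI.
  move=> x Jx /=; rewrite in_itv/=; apply/andP; split.
    by apply: ge_inf => //; case: hi.
  by apply: ub_le_sup => //; case: hs.
apply: le_trans (muG_cc is_) _; rewrite /G !clamp_id// ?ai ?sb ?(le_trans ai is_)//.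
by rewrite (le_trans is_ sb).
Qed.

(** A null set lies in an open set of small measure, which is a disjoint union
    of intervals I k.  Absolute continuity bounds the nu-measure of any finite
    number of them. *)
Let nu_dom : nu `<< mu.
Proof.
apply/null_content_dominatesP => A mA A0.
apply/eqP; rewrite eq_le measure_ge0 andbT; apply/lee_addgt0Pr => e e0.
rewrite add0e; have [d d0 H] := acg e0.
have [|U [oU AU UA]] := lebesgue_regularity_outer mA _ d0.
  by rewrite A0 ltry.
have mU : measurable U by exact: open_measurable.
have Ud : (mu U < d%:E)%E.
  rewrite -(setDUK AU) measureU//; last by rewrite setDIK.
    by rewrite A0 add0e.
  exact: measurableD.
pose I := open_disjoint_itv oU.
have mI k : measurable (I k).
  by apply: open_measurable; exact: open_disjoint_itv_open.
have UE : U = \bigcup_k I k by exact: open_disjoint_itv_bigcup.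
have tI : trivIset setT I by exact: open_disjoint_itv_trivIset.
apply: (@le_trans _ _ (nu U)); first by apply: le_measure; rewrite ?inE.
rewrite UE measure_semi_bigcup//; last by rewrite -UE.
have muU : (\sum_(k <oo) mu (I k) < d%:E)%E.
  by rewrite -measure_semi_bigcup// -?UE.
apply: lime_le; first exact: is_cvg_nneseries.
near=> n.
have iI k : is_interval (I k) by exact: open_disjoint_itv_is_interval.
have /choice[J HJ] := fun k => nu_interval (iI k) (mI k).
pose L := [seq J k | k <- iota 0 n].
have nL : nonoverlapping a b L.
  split.
    by apply/allP => _ /mapP[k _ ->]; have [-> -> ->] := HJ k.
  move=> x; rewrite /L count_map leqNgt; apply/negP => c2.
  pose F := [seq k <- iota 0 n | encloses x (J k)].
  have : (1 < size F)%N by rewrite size_filter.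
  have uF : uniq F by rewrite filter_uniq// iota_uniq.
  case E : F uF => [|i [|j s]]//= /andP[+ _] _.
  rewrite inE negb_or => /andP[ij _].
  have xi : encloses x (J i).
    have : i \in F by rewrite E inE eqxx.
    by rewrite mem_filter => /andP[].
  have xj : encloses x (J j).
    have : j \in F by rewrite E !inE eqxx orbT.
    by rewrite mem_filter => /andP[].
  move/negP: ij; apply; apply/eqP; apply: tI => //.
  have [_ _ _ h1 _] := HJ i; have [_ _ _ h2 _] := HJ j.
  by exists x; split; [exact: h1|exact: h2].
have Ld : total_length L < d.
  rewrite -lte_fin; apply: le_lt_trans muU.
  apply: le_trans (nneseries_lim_ge n _) => //.
  rewrite /total_length big_map -sumEFin; rewrite /index_iota subn0.
  apply: lee_sum => k _; have [h1 h2 h3 h4 _] := HJ k.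
  apply: (@le_trans _ _ (mu `](J k).2, (J k).1[%classic)).
    by rewrite lebesgue_measure_itv/= lte_fin; case: ltP => // h; rewrite lee_fin subr_le0.
  apply: le_measure; [by rewrite inE|by rewrite inE; exact: mI|].
  by move=> x /=; rewrite in_itv/= => xJ; exact: h4.
have := H L nL Ld; rewrite -lee_fin; apply: le_trans.
rewrite /oscillation big_map -sumEFin /index_iota subn0.
apply: lee_sum => k _; have [h1 h2 h3 h4 h5] := HJ k.
by apply: le_trans h5 _; rewrite lee_fin ler_norm.
Unshelve. all: by end_near. Qed.

(** The density is the Radon-Nikodym derivative of nu. *)
Lemma ac_nd_density : exists2 phi : R -> R,
  mu.-integrable [set: R] (EFin \o phi) &
  forall t, a <= t <= b -> g t - g a = \int[mu]_(s in `]a, t]) phi s.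
Proof.
have [f [f0 ffin intf fE]] := radon_nikodym_sigma_finite nu_dom.
exists (fine \o f).
  by apply: eq_integrable intf => // x _ /=; rewrite fineK.
move=> t /andP[at_ tb]; rewrite /Rintegral.
under eq_integral do rewrite /= fineK//.
rewrite -fE// nuE (_ : _ `&` _ = `]a, t]%classic); last first.
  apply/seteqP; split => x /=; rewrite !in_itv/=; first by move=> [].
  by move=> /andP[h1 h2]; rewrite h1 h2 (le_trans h2 tb).
by rewrite muG_oc//= /G !clamp_id// ?lexx ?at_ ?tb ?ab.
Qed.

End MonotoneDensity.

Section AcFtc.
Context {R : realType}.
Notation mu := (@lebesgue_measure R).

(** Lebesgue's theorem.  Integrals come from the densities of the two monotone
    parts, the derivative from Lebesgue differentiation. *)
Lemma ac_ftc (a b : R) (w : R -> R) : a < b -> ac_on a b w ->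
  exists phi : R -> R, [/\ mu.-integrable [set: R] (EFin \o phi),
    (forall t, a <= t <= b -> w t = w a + \int[mu]_(s in `]a, t]) phi s) &
    {ae mu, forall t, a < t < b -> derivable w t 1 /\ derive1 w t = phi t}].
Proof.
move=> ab acw; have ab' := ltW ab.
have [f1 i1 E1] := ac_nd_density ab' (tv_nd acw) (tv_ac acw).
have [f2 i2 E2] := ac_nd_density ab' (tvB_nd acw) (ac_onB (tv_ac acw) acw).
pose phi x := f1 x - f2 x.
have iphi : mu.-integrable [set: R] (EFin \o phi).
  have := integrableB measurableT i1 i2.
  by apply: eq_integrable => // x _.
have E t : a <= t <= b -> w t = w a + \int[mu]_(s in `]a, t]) phi s.
  move=> abt; rewrite RintegralB//; last 2 first.
  - exact: integrableS i1.
  - exact: integrableS i2.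
  by rewrite -E1// -E2//; ring.
exists phi; split => //.
have := @lebesgue_differentiation R phi (open_integrable_locally openT iphi).
apply: (@filterS _ _ (ae_filter_ringOfSetsType mu)) => t lt /andP[at_ tb].
have tb1 : t < t + 1 by rewrite ltrDl.
have iS : mu.-integrable `]a, t + 1] (EFin \o phi) by exact: integrableS iphi.
have [] := @FTC1_lebesgue_pt R phi (BRight a) t (t + 1) tb1 iS _ lt.
  exact: at_.
set F := fun y : R => _ => dF F't.
have nE : \forall s \near t, w s = w a + F s.
  have : \forall s \near t, s \in `]a, b[.
    by apply: near_in_itvoo; rewrite in_itv/= at_ tb.
  apply: filterS => s; rewrite in_itv/= => /andP[h1 h2]; apply: E.
  by rewrite !ltW.
have nE' : {near t, (fun s => w a + F s) =1 w} by apply: filterS nE => s ->.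
split.
  by apply: near_eq_derivable nE' _; apply: derivableD.
rewrite derive1E (near_eq_derive _ nE) deriveD//.
by rewrite derive_cst add0r -derive1E.
Qed.

End AcFtc.

(** * Rules for convolutions *)

Section ConvolutionTools.
Context {R : realType}.
Notation mu := (@lebesgue_measure R).

Definition cintegrable (m : R) (f : R -> R) (t : R) : bool :=
  mu.-integrable [set: R] (fun s : R => (fker m (t - s) * f s)%:E).

Lemma conv_eq (m : R) (f g : R -> R) (t : R) :
  (forall s, s < t -> f s = g s) -> conv m f t = conv m g t.
Proof.
move=> fg; apply: eq_Rintegral => s _; have [st|ts] := ltP s t; first by rewrite fg.
by rewrite fker_le0 ?subr_le0// !mul0r.
Qed.

Lemma conv_ae_eq (m : R) (f g : R -> R) (t : R) :
  {ae mu, forall s, s < t -> f s = g s} -> conv m f t = conv m g t.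
Proof.
move=> fg; apply: ae_eq_Rintegral_any.
apply: (@filterS _ _ (ae_filter_ringOfSetsType mu) _ _ _ fg) => s E.
have [st|ts] := ltP s t; first by rewrite E.
by rewrite fker_le0 ?subr_le0// !mul0r.
Qed.

(** Causality: only the values of f on (a, t) enter. *)
Lemma conv_left0 (m : R) (f : R -> R) (a t : R) :
  (forall s, s <= a -> f s = 0) -> t <= a -> conv m f t = 0.
Proof.
move=> f0 ta; rewrite (@conv_eq _ _ (fun=> 0)).
  by rewrite /conv /Rintegral; under eq_integral do rewrite mulr0; rewrite integral0.
by move=> s st; apply: f0; rewrite (le_trans (ltW st)).
Qed.

Lemma convD (m : R) (f g : R -> R) (t : R) :
  cintegrable m f t -> cintegrable m g t ->
  cintegrable m (fun s => f s + g s) t /\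
  conv m (fun s => f s + g s) t = conv m f t + conv m g t.
Proof.
move=> fi gi; split.
  have := integrableD measurableT fi gi.
  by apply: eq_integrable => // s _ /=; rewrite -EFinD mulrDr.
rewrite /conv -RintegralD//; apply: eq_Rintegral => s _; exact: mulrDr.
Qed.

Lemma convZ (m c : R) (f : R -> R) (t : R) :
  cintegrable m f t ->
  cintegrable m (fun s => c * f s) t /\
  conv m (fun s => c * f s) t = c * conv m f t.
Proof.
move=> fi; split.
  have := integrableZl measurableT c fi.
  by apply: eq_integrable => // s _ /=; rewrite -EFinM mulrCA.
rewrite /conv -RintegralZl//; apply: eq_Rintegral => s _; exact: mulrCA.
Qed.

Lemma measurable_fker_shift (m a : R) : measurable_fun [set: R] (fun s => fker m (s - a)).
Proof. by apply: (measurableT_comp (measurable_fker m)); exact: measurable_funB. Qed.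

Lemma fker_conv_shift (m n a t : R) : 0 < m -> 0 < n ->
  cintegrable m (fun s => fker n (s - a)) t /\
  conv m (fun s => fker n (s - a)) t = fker (m + n) (t - a).
Proof.
move=> m0 n0; have E := fker_conv t a m0 n0; split; last by rewrite /conv /Rintegral E.
apply/integrableP; split.
  apply/measurable_EFinP; apply: measurable_funM; first exact: measurable_fkerB.
  exact: measurable_fker_shift.
rewrite (eq_integral (fun s : measurableTypeR R => (fker m (t - s) * fker n (s - a))%:E)).
  by rewrite E ltry.
by move=> s _; rewrite gee0_abs// lee_fin mulr_ge0 ?fker_ge0.
Qed.

(** Weakly singular functions have fractional integrals of all orders at every
    point. *)
Lemma cintegrable_dom (m n C a t : R) (f : R -> R) : 0 < m -> 0 < n ->
  measurable_fun [set: R] f ->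
  (forall s, `|f s| <= C * fker n (s - a)) -> cintegrable m f t.
Proof.
move=> m0 n0 mf fC; have [gi _] := fker_conv_shift a t m0 n0.
have [{}gi _] := convZ C gi.
apply: le_integrable gi => //.
  by apply/measurable_EFinP; apply: measurable_funM => //; exact: measurable_fkerB.
move=> s _ /=; rewrite lee_fin [leLHS]normrM [leRHS]normrM ler_wpM2l//.
exact: le_trans (fC s) (ler_norm _).
Qed.

(** For orders at least 1 the kernel is bounded on bounded sets, so that
    integrability of f suffices, at every point. *)
Lemma cintegrable_ge1 (m a t : R) (f : R -> R) : 1 <= m ->
  mu.-integrable [set: R] (EFin \o f) -> (forall s, s <= a -> f s = 0) ->
  cintegrable m f t.
Proof.
move=> m1 fi f0; have m0 : 0 < m by exact: lt_le_trans m1.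
have mf : measurable_fun [set: R] f by apply/measurable_EFinP; exact: measurable_int fi.
have := integrableZl measurableT (`|t - a| `^ (m - 1) / Gamma m) fi.
apply: le_integrable => //.
  by apply/measurable_EFinP; apply: measurable_funM => //; exact: measurable_fkerB.
move=> s _ /=; rewrite lee_fin [leLHS]normrM [leRHS]normrM.
have [sa|as_] := leP s a; first by rewrite f0// normr0 !mulr0.
have G0 := Gamma_gt0 m0.
rewrite ler_wpM2r// (ger0_norm (fker_ge0 _ m0)) [leRHS]normrM normfV (gtr0_norm G0) (ger0_norm (powR_ge0 _ _)).
have [st|ts] := ltP s t; last first.
  by rewrite fker_le0 ?subr_le0// divr_ge0 ?powR_ge0// ltW.
rewrite /fker tpowE ?subr_gt0// ler_wpM2r ?invr_ge0 ?(ltW G0)//.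
apply: ge0_ler_powR.
- by rewrite subr_ge0.
- by rewrite nnegrE subr_ge0 ltW.
- by rewrite nnegrE.
by apply: le_trans (ler_norm _); rewrite lerD2l lerN2 ltW.
Qed.

Lemma fker1E (u : R) : fker 1 u = if 0 < u then 1 else 0.
Proof. by rewrite /fker /tpow Gamma1 divr1 subrr powRr0. Qed.

Lemma conv1E (f : R -> R) (t : R) : conv 1 f t = \int[mu]_(s in `]-oo, t[) f s.
Proof.
rewrite /conv [RHS]Rintegral_mkcond; apply: eq_Rintegral => s _.
rewrite patchE mem_setE in_itv/= fker1E subr_gt0.
by case: ifP; rewrite ?mul1r ?mul0r.
Qed.

Lemma RLint_conv (a b m t : R) (y : R -> R) : 0 < m -> a < t -> t <= b ->
  measurable_fun [set: R] (y \_ `]a, b[) ->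
  RLint a m y t = conv m (y \_ `]a, b[) t.
Proof.
move=> m0 at_ tb my; rewrite /RLint gt_eqF// Rintegral_mkcond.
transitivity ((Gamma m)^-1 * \int[mu]_s (tpow m (t - s) * (y \_ `]a, b[) s)).
  congr (_ * _); apply: eq_Rintegral => s _; rewrite !patchE !mem_setE !in_itv/=.
  rewrite /tpow subr_gt0; case: (ltP a s) => //= as_; last by rewrite mulr0.
  case: (ltP s t) => //= st; last by rewrite mul0r.
  by rewrite (lt_le_trans st tb).
rewrite -Rintegral_scale_gt0 ?invr_gt0 ?Gamma_gt0//.
  by apply: eq_Rintegral => s _; rewrite /fker; ring.
by apply: measurable_funM => //; exact: measurable_tpowB.
Qed.

(** A function with vanishing primitive is 0 at its Lebesgue points. *)
Lemma conv1_eq0_ae (b : R) (f : R -> R) :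
  cintegrable 1 f b -> (forall t, t <= b -> conv 1 f t = 0) ->
  {ae mu, forall t, t < b -> f t = 0}.
Proof.
move=> fi f0; pose g := f \_ `]-oo, b[.
have gi : mu.-integrable [set: R] (EFin \o g).
  apply: eq_integrable fi => // s _ /=.
  rewrite /g patchE mem_setE in_itv/= fker1E subr_gt0.
  by case: ifP; rewrite ?mul1r ?mul0r.
have := @lebesgue_differentiation R g (open_integrable_locally openT gi).
apply: (@filterS _ _ (ae_filter_ringOfSetsType mu)) => t lt tb.
have iS : mu.-integrable `]-oo, b] (EFin \o g) by exact: integrableS gi.
have [|_] := @FTC1_lebesgue_pt R g -oo%O t b tb iS _ lt; first by rewrite ltNyr.
have gE (x : R) : x < b -> g x = f x by move=> xb; rewrite /g patchE mem_set//= in_itv.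
rewrite (gE _ tb).
set F := fun y : R => _ => F't.
have nF : \forall x \near t, F x = 0.
  near=> x; rewrite /F -(f0 x); last first.
    by apply/ltW; near: x; exact: lt_nbhsl.
  rewrite conv1E -Rintegral_itv_bndo_bndc; last exact: integrableS gi.
  apply: eq_Rintegral => s /set_mem/=; rewrite in_itv/= => sx.
  rewrite gE// (lt_trans sx)//.
  by near: x; exact: lt_nbhsl.
rewrite -F't derive1E (near_eq_derive (g := fun=> 0) _ nF).
by rewrite derive_cst.
Unshelve. all: by end_near. Qed.

End ConvolutionTools.

(** * Derivatives relative to a closed interval *)

Section OneSidedCalculus.
Context {R : realType}.
Notation mu := (@lebesgue_measure R).
Variables (a b : R) (f : R -> R).

(** The definition with explicit epsilons, free of the filter of punctured
    neighbourhoods within the interval. *)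
Lemma derive_on_eps (x : R) : derivable_on a b f x ->
  forall e, 0 < e -> exists2 d, 0 < d & forall s, `|x - s| < d -> s != x ->
    a <= s <= b -> `|derive_on a b f x - (f s - f x) / (s - x)| < e.
Proof.
move=> dx e e0.
have : (f s - f x) / (s - x) @[s --> within `[a, b] x^'] --> derive_on a b f x by exact: dx.
by move=> /cvgrPdist_lt/(_ _ e0) [d /= d0 H]; exists d.
Qed.

Lemma derive_on_interior (x : R) : a < x < b -> derivable_on a b f x ->
  derivable f x 1 /\ derive1 f x = derive_on a b f x.
Proof.
move=> /andP[ax xb] dx.
have K : h^-1 *: (f (h + x) - f x) @[h --> 0^'] --> derive_on a b f x.
  apply/cvgrPdist_lt => e e0; have [d d0 H] := derive_on_eps dx e0.
  near=> h.
  have h0 : h != 0 by near: h; exact: nbhs_dnbhs_neq.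
  have := H (h + x); rewrite opprD addrCA subrr addr0 normrN addrK.
  rewrite [_ *: _]mulrC; apply.
  - by near: h; exact: dnbhs0_lt.
  - by rewrite -subr_eq0 addrK.
  have hm : `|h| < Num.min (x - a) (b - x).
    by near: h; apply: dnbhs0_lt; rewrite lt_min !subr_gt0 ax.
  move: hm; rewrite lt_min !ltr_norml => /andP[/andP[h1 h2] /andP[h3 h4]].
  by apply/andP; split; lra.
split; last by apply/cvg_lim.
apply/cvg_ex; exists (derive_on a b f x); move: K.
by under eq_fun do rewrite -[X in f (X + x)]mulr1.
Unshelve. all: by end_near. Qed.

Lemma derive_on_continuous (x : R) : derivable_on a b f x ->
  forall e, 0 < e -> exists2 d, 0 < d & forall s, `|x - s| < d ->
    a <= s <= b -> `|f x - f s| < e.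
Proof.
move=> dx e e0; have [d d0 H] := derive_on_eps dx ltr01.
pose K := `|derive_on a b f x| + 1.
have K0 : 0 < K by rewrite ltr_wpDl.
exists (Num.min d (e / K)); first by rewrite lt_min d0 divr_gt0.
move=> s; rewrite lt_min => /andP[sd seK] sab.
have [->|sx] := eqVneq s x; first by rewrite subrr normr0.
have := H s sd sx sab => h.
have q : `|(f s - f x) / (s - x)| < K.
  rewrite /K -ltrBlDl; apply: le_lt_trans h; rewrite distrC; exact: lerB_dist.
rewrite distrC; have -> : f s - f x = (f s - f x) / (s - x) * (s - x).
  by rewrite divfK// subr_eq0.
rewrite normrM; apply: (@le_lt_trans _ _ (K * `|s - x|)).
  by rewrite ler_wpM2r// ltW.
by rewrite mulrC -ltr_pdivlMr// distrC.
Qed.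

Hypothesis ab : a < b.
Hypothesis df : forall x, x \in `[a, b] -> derivable_on a b f x.

Lemma derive_on_cvg_right (x : R) : a <= x < b -> f s @[s --> x^'+] --> f x.
Proof.
move=> /andP[ax xb]; apply/cvgrPdist_lt => e e0.
have [|d d0 H] := derive_on_continuous (x := x) _ e0.
  by apply: df; rewrite in_itv/= ax ltW.
near=> s; have xs : x < s by near: s; exact: nbhs_right_gt.
apply: H.
  rewrite ltr0_norm ?subr_lt0// opprB ltrBlDl; near: s; apply: nbhs_right_lt.
  by rewrite ltrDl.
rewrite (le_trans ax (ltW xs))/= ltW//; near: s; exact: nbhs_right_lt.
Unshelve. all: by end_near. Qed.

Lemma derive_on_cvg_left (x : R) : a < x <= b -> f s @[s --> x^'-] --> f x.
Proof.
move=> /andP[ax xb]; apply/cvgrPdist_lt => e e0.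
have [|d d0 H] := derive_on_continuous (x := x) _ e0.
  by apply: df; rewrite in_itv/= xb ltW.
near=> s; have xs : s < x by near: s; exact: nbhs_left_lt.
apply: H.
  rewrite gtr0_norm ?subr_gt0// ltrBlDl -ltrBlDr; near: s; apply: nbhs_left_gt.
  by rewrite ltrBlDr ltrDl.
rewrite (le_trans (ltW xs) xb) andbT ltW//; near: s; exact: nbhs_left_gt.
Unshelve. all: by end_near. Qed.

(** Reduces to the fundamental theorem for continuous derivatives, which asks
    for two-sided derivatives inside and one-sided continuity at the ends. *)
Lemma FTC_derive_on (t : R) : {within `[a, b], continuous (derive_on a b f)} ->
  a <= t <= b -> f t - f a = \int[mu]_(s in `]a, t[) derive_on a b f s.
Proof.
move=> cw /andP[]; rewrite le_eqVlt => /predU1P[<- _|at_ tb].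
  by rewrite subrr set_itvoo0 Rintegral_set0.
have cwt : {within `[a, t], continuous (derive_on a b f)}.
  by apply: continuous_subspaceW cw; apply: subset_itvl; rewrite bnd_simp.
have int := continuous_compact_integrable (@segment_compact _ a t) cwt.
have io : mu.-integrable `]a, t] (EFin \o derive_on a b f).
  by apply: integrableS int => //; exact: subset_itv_oc_cc.
rewrite Rintegral_itv_bndo_bndc; last first.
  by apply: integrableS int => //; exact: subset_itv_oo_cc.
rewrite Rintegral_itv_obnd_cbnd// /Rintegral (continuous_FTC2 at_ cwt (F := f))//.
  split.
  - move=> x; rewrite in_itv/= => /andP[ax xt].
    have xb := lt_le_trans xt tb.
    have axb : a < x < b by rewrite ax.
    have xin : x \in `[a, b] by rewrite in_itv/= !ltW.
    by have [] := derive_on_interior axb (df xin).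
  - by apply: derive_on_cvg_right; rewrite lexx.
  - by apply: derive_on_cvg_left; rewrite at_.
move=> x; rewrite in_itv/= => /andP[ax xt].
have xb := lt_le_trans xt tb.
have axb : a < x < b by rewrite ax.
have xin : x \in `[a, b] by rewrite in_itv/= !ltW.
by have [] := derive_on_interior axb (df xin).
Qed.

End OneSidedCalculus.

(** * Weighted continuous functions *)

Section BoundedContinuous.
Context {R : realType}.

Lemma bounded_continuous (a b : R) (q : R -> R) : a <= b -> {within `[a, b], continuous q} ->
  exists2 Q, 0 <= Q & forall s, a <= s <= b -> `|q s| <= Q.
Proof.
move=> ab hq.
have cq : {within `[a, b], continuous (fun t => `|q t|)}.
  by move=> t; apply: (@cvg_norm R R^o); exact: hq.
have [t1 _ Hq] := EVT_max ab cq.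
by exists `|q t1| => // s sab; apply: Hq; rewrite in_itv.
Qed.

End BoundedContinuous.

Section Weighted.
Context {R : realType}.
Notation mu := (@lebesgue_measure R).
Variables (a b gamma : R) (y : R -> R).
Hypotheses (ab : a < b) (gamma1 : gamma < 1).
Hypothesis Cy : C_weighted a b gamma y.

Let X := extend_left a (fun t => (t - a) `^ gamma * y t).

Lemma extend_left_gt (f : R -> R) t : a < t -> extend_left a f t = f t.
Proof. by move=> at_; rewrite /extend_left gt_eqF. Qed.

Lemma weightedK t : a < t -> y t = (t - a) `^ (- gamma) * X t.
Proof.
move=> at_; rewrite /X extend_left_gt// mulrA -powRD; last first.
  by rewrite subr_eq0 (gt_eqF at_) implybT.
by rewrite addNr powRr0 mul1r.
Qed.

Lemma weighted_max : exists2 t0, a <= t0 <= b & forall t, a <= t <= b -> `|X t| <= `|X t0|.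
Proof.
have cX : {within `[a, b], continuous (fun t => `|X t|)}.
  move=> t; apply: (@cvg_norm R R^o); exact: Cy.
have [t0 t0ab H] := EVT_max (ltW ab) cX.
exists t0; first by move: t0ab; rewrite in_itv.
by move=> t tab; apply: H; rewrite in_itv.
Qed.

Lemma measurable_weighted : measurable_fun [set: R] (y \_ `]a, b[).
Proof.
apply/(measurable_restrictT _ _).1 => //.
apply: (eq_measurable_fun (fun t : R => (t - a) `^ (- gamma) * X t)).
  by move=> t /set_mem/=; rewrite in_itv/= => /andP[at_ _]; rewrite -weightedK.
apply: measurable_funM.
  apply: measurable_funTS; apply: (measurableT_comp (measurable_powR _)).
  exact: measurable_funB.
apply: subspace_continuous_measurable_fun => //.
by apply: continuous_subspaceW Cy; exact: subset_itv_oo_cc.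
Qed.

Lemma weighted_bound (M : R) : (forall t, a <= t <= b -> `|X t| <= M) ->
  forall s, `|(y \_ `]a, b[) s| <= M * Gamma (1 - gamma) * fker (1 - gamma) (s - a).
Proof.
move=> HM s; have g0 : 0 < 1 - gamma by rewrite subr_gt0.
have M0 : 0 <= M by apply: le_trans (HM a _) => //; rewrite lexx ltW.
rewrite patchE mem_setE in_itv/=; case: ifPn => [/andP[as_ sb]|_]; last first.
  by rewrite normr0; apply: mulr_ge0; [exact: mulr_ge0 M0 (ltW (Gamma_gt0 g0))|exact: fker_ge0].
rewrite weightedK// normrM ger0_norm ?powR_ge0// mulrC /fker tpowE ?subr_gt0//.
rewrite (_ : 1 - gamma - 1 = - gamma); last by ring.
rewrite -mulrA [Gamma _ * _]mulrC divfK ?gt_eqF ?Gamma_gt0//.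
by rewrite ler_wpM2r ?powR_ge0// HM// !ltW.
Qed.

End Weighted.

Section AeDense.
Context {R : realType}.
Notation mu := (@lebesgue_measure R).

(** How an almost everywhere estimate is evaluated near a maximum point. *)
Lemma ae_exists_itv (c d : R) (P : R -> Prop) : c < d ->
  {ae mu, forall t, P t} -> exists2 t, c < t < d & P t.
Proof.
move=> cd [N [mN N0 PN]]; apply: contrapT => H.
have : `]c, d[%classic `<=` N.
  move=> t /=; rewrite in_itv/= => tcd; apply: PN => Pt; apply: H.
  by exists t.
move=> /(@le_measure _ _ _ mu); rewrite !inE => /(_ (measurable_itv _) mN).
rewrite [X in (_ <= X)%E]N0 /= lebesgue_measure_itv/= lte_fin cd -EFinB lee_fin.
by rewrite leNgt subr_gt0 cd.
Qed.

End AeDense.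

(** * From the boundary value problem to an integral equation *)

Section Representation.
Context {R : realType}.
Notation mu := (@lebesgue_measure R).
Variables (a b alpha beta : R) (q y : R -> R).
Hypotheses (ab : a < b) (halpha : 1 < alpha <= 2) (hbeta : 0 <= beta <= 1).
Hypothesis hq : {within `[a, b], continuous q}.

Let gamma := (2 - alpha) * (1 - beta).
Let delta := beta * (2 - alpha).
Let v := extend_left a (RLint a gamma y).
Let w := derive_on a b v.
Hypothesis Cy : C_weighted a b gamma y.
Hypothesis ACv : AC2 a b v.
Hypothesis eqn : {ae mu, forall t, a < t < b -> hilfer a alpha beta y t + q t * y t = 0}.

Let y_ := y \_ `]a, b[.
Let h_ := (fun t => - (q t * y t)) \_ `]a, b[.

Lemma hilfer_orders : [/\ 0 <= gamma, 0 <= delta, gamma < 1, delta < 1 & gamma + delta = 2 - alpha].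
Proof.
rewrite /gamma /delta; case/andP: halpha => a1 a2; case/andP: hbeta => b0 b1.
split; [by apply: mulr_ge0; lra|by apply: mulr_ge0; lra| | |by ring].
- apply: (@le_lt_trans _ _ ((2 - alpha) * 1)); last by lra.
  by apply: ler_wpM2l; lra.
- apply: (@le_lt_trans _ _ (1 * (2 - alpha))); last by lra.
  by apply: ler_wpM2r; lra.
Qed.

Let patch_lt (f : R -> R) s : a < s < b -> (f \_ `]a, b[) s = f s.
Proof. by move=> asb; rewrite patchE mem_set//= in_itv. Qed.

Let patch_le (f : R -> R) s : s <= a -> (f \_ `]a, b[) s = 0.
Proof.
by move=> sa; rewrite patchE mem_setE in_itv/= ltNge sa.
Qed.

Lemma weighted_source_bound : exists2 C, 0 <= C & measurable_fun [set: R] h_ /\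
  forall s, `|h_ s| <= C * fker (1 - gamma) (s - a).
Proof.
have [g0 d0 g1 d1 gd] := hilfer_orders.
have [t0 _ HX] := weighted_max ab Cy.
have [Q Q0 HQ] := bounded_continuous (ltW ab) hq.
have hE : h_ = (fun t => - ((q \_ `]a, b[) t * y_ t)).
  apply/funext => t; rewrite /h_ /y_ !patchE; case: ifP => // _.
  by rewrite mulr0 oppr0.
have my : measurable_fun [set: R] y_ by exact: (measurable_weighted Cy).
have mh : measurable_fun [set: R] h_.
  rewrite hE; apply: measurableT_comp => //; apply: measurable_funM => //.
  apply/(measurable_restrictT _ _).1 => //.
  apply: subspace_continuous_measurable_fun => //.
  by apply: continuous_subspaceW hq; exact: subset_itv_oo_cc.
set X0 := `|extend_left a _ t0| in HX.
have G0 : 0 < Gamma (1 - gamma) by apply: Gamma_gt0; lra.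
exists (Q * (X0 * Gamma (1 - gamma))).
  by rewrite mulr_ge0 // mulr_ge0 ?normr_ge0 ?(ltW G0).
split => // s; rewrite hE normrN normrM -mulrA.
apply: ler_pM => //; last exact: (weighted_bound ab g1 HX).
rewrite patchE; case: ifP => [/set_mem/=|_]; last by rewrite normr0.
by rewrite in_itv/= => /andP[h1 h2]; apply: HQ; rewrite !ltW.
Qed.

(** The function phi is almost everywhere the second derivative of v on
    (a, b), and 0 outside.  The last property is the differential equation in
    the only form used afterwards: a fractional integral of phi of order
    m + delta is one of order m of h.  For delta = 0 the equation is phi = h;
    for delta > 0 it is the semigroup law.  The bound 1 <= m + delta makes it
    hold at every t, although phi is only integrable. *)
Lemma bvp_density : exists phi : R -> R,
  [/\ mu.-integrable [set: R] (EFin \o phi),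
    forall s, s <= a -> phi s = 0,
    forall t, a <= t <= b -> w t = w a + conv 1 phi t &
    forall m t, 0 < m -> 1 <= m + delta -> t <= b -> conv (m + delta) phi t = conv m h_ t].
Proof.
have [g0 d0 g1 d1 gd] := hilfer_orders.
have [dv cw acw] := ACv.
have [phi [iphi wE dE]] := ac_ftc ab (abs_continuousP acw).
pose phi_ := phi \_ `]a, b[.
have iphi_ : mu.-integrable [set: R] (EFin \o phi_).
  rewrite /phi_ -restrict_EFin; apply/(integrable_mkcond _ _).1 => //.
  exact: integrableS iphi.
have phi0 s : s <= a -> phi_ s = 0 by exact: patch_le.
exists phi_; split => //.
  move=> t /andP[at_ tb]; rewrite /w wE ?at_//; congr (_ + _).
  rewrite conv1E -Rintegral_itv_bndo_bndc; last exact: integrableS iphi.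
  rewrite [LHS]Rintegral_mkcond [RHS]Rintegral_mkcond; apply: eq_Rintegral => s _.
  rewrite !patchE !mem_setE !in_itv/=; case: (ltP s t) => st; last by rewrite andbF.
  by rewrite /phi_ patchE mem_setE in_itv/= (lt_le_trans st tb).
(* The derivatives of the definition agree near t with those of v. *)
have der t : a < t < b -> derive1 w t = derive1n 2 (RLint a gamma y) t.
  move=> /andP[at_ tb].
  have E s : a < s < b -> derive1 (RLint a gamma y) s = w s.
    move=> /andP[as_ sb].
    have sab : s \in `[a, b] by rewrite in_itv/= !ltW.
    have asb : a < s < b by rewrite as_.
    rewrite /w; have [_ <-] := derive_on_interior asb (dv _ sab).
    rewrite !derive1E; apply: near_eq_derive; near=> r.
    by rewrite /v extend_left_gt//; near: r; exact: lt_nbhsr.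
  rewrite /= !derive1E; apply: near_eq_derive.
  have : \forall s \near t, s \in `]a, b[.
    by apply: near_in_itvoo; rewrite in_itv/= at_ tb.
  by apply: filterS => s; rewrite in_itv/= => sab; rewrite -E.
have d2 : {ae mu, forall t, a < t < b -> derive1n 2 (RLint a gamma y) t = phi t}.
  apply: (@filterS _ _ (ae_filter_ringOfSetsType mu) _ _ _ dE) => t H tab.
  by have [_ <-] := H tab; rewrite der.
have mphi : measurable_fun [set: R] phi_.
  by apply/measurable_EFinP; exact: measurable_int iphi_.
have src : {ae mu, forall t, a < t < b -> hilfer a alpha beta y t = h_ t}.
  apply: (@filterS _ _ (ae_filter_ringOfSetsType mu) _ _ _ eqn) => t H tab.
  by rewrite /h_ patch_lt//; have := H tab; move/eqP; rewrite addr_eq0 => /eqP.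
move: d0; rewrite le_eqVlt => /predU1P[d0|d0].
  have ae1 : {ae mu, forall t, t < b -> phi_ t = h_ t}.
    have := @filterI _ _ (ae_filter_ringOfSetsType mu) _ _ d2 src.
    apply: (@filterS _ _ (ae_filter_ringOfSetsType mu)) => t [H1 H2] tb.
    have [ta|at_] := leP t a; first by rewrite phi0 // /h_ patch_le.
    have tab : a < t < b by rewrite at_.
    by rewrite /phi_ patch_lt// -H1// -H2// /hilfer /RLint -/delta -d0 eqxx.
  move=> m t m0 _ tb; rewrite -d0 addr0; apply: conv_ae_eq.
  apply: (@filterS _ _ (ae_filter_ringOfSetsType mu) _ _ _ ae1) => s H st.
  by apply: H; exact: lt_le_trans tb.
have ae1 : {ae mu, forall t, t < b -> conv delta phi_ t = h_ t}.
  apply: (@filterS _ _ (ae_filter_ringOfSetsType mu) _ _ _ src) => t H tb.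
  have [ta|at_] := leP t a; first by rewrite (conv_left0 _ phi0 ta) /h_ patch_le.
  rewrite -H ?at_//; pose g := derive1n 2 (RLint a gamma y).
  rewrite -[hilfer _ _ _ _ _]/(RLint a delta g t).
  rewrite -(RLint_conv d0 at_ (ltW tb) mphi) /RLint gt_eqF//; congr (_ * _).
  rewrite [LHS]Rintegral_mkcond [RHS]Rintegral_mkcond; apply: ae_eq_Rintegral_any.
  apply: (@filterS _ _ (ae_filter_ringOfSetsType mu) _ _ _ d2) => s H2.
  rewrite !patchE mem_setE in_itv/=; case: ifPn => // /andP[as_ st].
  by rewrite /g H2// as_ (lt_trans st tb).
move=> m t m0 md tb.
have [_ <-] := @conv_semigroup _ m delta phi_ t m0 d0 mphi (cintegrable_ge1 t md iphi_ phi0).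
apply: conv_ae_eq.
apply: (@filterS _ _ (ae_filter_ringOfSetsType mu) _ _ _ ae1) => s H st.
by apply: H; exact: lt_le_trans tb.
Unshelve. all: by end_near. Qed.

End Representation.

Section IntegralEquation.
Context {R : realType}.
Notation mu := (@lebesgue_measure R).
Variables (a b gamma delta alpha C : R) (y h phi v w : R -> R).
Hypothesis ab : a < b.
Hypotheses (gamma0 : 0 <= gamma) (gamma1 : gamma < 1).
Hypotheses (delta0 : 0 <= delta) (delta1 : delta < 1) (alpha1 : 1 < alpha).
Hypothesis gda : gamma + delta = 2 - alpha.
Hypotheses (my : measurable_fun [set: R] y) (mh : measurable_fun [set: R] h).
Hypothesis yC : forall s, `|y s| <= C * fker (1 - gamma) (s - a).
Hypothesis hC : forall s, `|h s| <= C * fker (1 - gamma) (s - a).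
Hypothesis iphi : mu.-integrable [set: R] (EFin \o phi).
Hypothesis phi0 : forall s, s <= a -> phi s = 0.
Hypothesis wE : forall t, a <= t <= b -> w t = w a + conv 1 phi t.
Hypothesis phih : forall (m t : R), 0 < m -> 1 <= m + delta -> t <= b ->
  conv (m + delta) phi t = conv m h t.
Hypothesis vw : forall t, a <= t <= b -> v t - v a = \int[mu]_(s in `]a, t[) w s.
Hypothesis vy : forall t, a < t < b -> v t = if gamma == 0 then y t else conv gamma y t.

Let mphi : measurable_fun [set: R] phi.
Proof. by apply/measurable_EFinP; exact: measurable_int iphi. Qed.

Let g1_gt0 : 0 < 1 - gamma. Proof. by rewrite subr_gt0. Qed.

Lemma fker2E (u : R) : 0 <= u -> fker 2 u = u.
Proof.
rewrite le_eqVlt => /predU1P[<-|u0]; first by rewrite fker_le0.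
rewrite /fker tpowE// (_ : 2 = 1 + 1 :> R)// GammaS// Gamma1 mulr1 divr1.
by rewrite addrK powRr1// ltW.
Qed.

Let y0 s : s <= a -> y s = 0.
Proof.
move=> sa; apply/eqP; rewrite -normr_eq0 eq_le normr_ge0 andbT.
by apply: le_trans (yC s) _; rewrite fker_le0 ?subr_le0// mulr0.
Qed.

Let semi_phi (m n t : R) : 0 < m -> 0 < n -> 1 <= m + n ->
  cintegrable m (conv n phi) t /\ conv m (conv n phi) t = conv (m + n) phi t.
Proof.
by move=> m0 n0 mn; apply: conv_semigroup => //; exact: cintegrable_ge1 iphi phi0.
Qed.

Let semi_dom (m n t : R) (f : R -> R) : 0 < m -> 0 < n -> measurable_fun [set: R] f ->
  (forall s, `|f s| <= C * fker (1 - gamma) (s - a)) ->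
  cintegrable m (conv n f) t /\ conv m (conv n f) t = conv (m + n) f t.
Proof.
move=> m0 n0 mf fC; apply: conv_semigroup => //.
by have := @cintegrable_dom _ (m + n) (1 - gamma) C a t f (addr_gt0 m0 n0) g1_gt0 mf fC.
Qed.

(** Taylor's formula for v at a, with remainder written as a convolution. *)
Lemma second_primitive (t : R) : a <= t <= b -> v t = v a + w a * (t - a) + conv 2 phi t.
Proof.
move=> /andP[at_ tb].
have [i1 e1] := fker_conv_shift a t (@ltr01 R) (@ltr01 R).
have [i2 e2] := convZ (w a) i1.
have [i3 e3] := semi_phi t (@ltr01 R) (@ltr01 R) (ler_wpDr ler01 (lexx 1)).
have [i4 e4] := convD i2 i3.
have : conv 1 (fun s => w a * fker 1 (s - a) + conv 1 phi s) t = v t - v a.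
  rewrite vw ?at_// conv1E [LHS]Rintegral_mkcond [RHS]Rintegral_mkcond.
  apply: eq_Rintegral => s _; rewrite !patchE !mem_setE !in_itv/=.
  case: (ltP s t) => st; last by rewrite andbF.
  have [as_|sa] := ltP a s; last first.
    by rewrite (conv_left0 _ phi0 sa) fker_le0 ?subr_le0// mulr0 addr0.
  have asb : a <= s <= b by rewrite (ltW as_) (le_trans (ltW st) tb).
  by rewrite (wE asb) fker1E subr_gt0 as_ mulr1.
rewrite e4 e2 e1 e3 (_ : 1 + 1 = 2)// fker2E ?subr_ge0// => /eqP.
by rewrite eq_sym subr_eq => /eqP ->; ring.
Qed.

Lemma boundary_v : v b = v a + w a * (b - a) + conv (2 - delta) h b.
Proof.
rewrite second_primitive ?lexx ?ltW//; congr (_ + _).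
have := @phih (2 - delta) b; rewrite subrK => <-//; last by rewrite ler1n.
by move: delta1 => d1; lra.
Qed.

Lemma boundary_w : w b = w a + conv (1 - delta) h b.
Proof. rewrite wE ?lexx ?ltW//; have := @phih (1 - delta) b; rewrite subrK => <-//.
by rewrite subr_gt0. Qed.

Let r1 s := v a * fker (1 - gamma) (s - a) + w a * fker (2 - gamma) (s - a).

(** Both sides are shown to have the same primitive.  For y it is
    k_(1 - gamma) * v, also when gamma = 0 and v = y. *)
Lemma integral_equation :
  {ae mu, forall t, t < b -> y t = r1 t + conv alpha h t}.
Proof.
have [g0 g1] := conj gamma0 gamma1; have [d0 d1] := conj delta0 delta1.
have [al1 gd] := conj alpha1 gda.
have g2_gt0 : 0 < 2 - gamma by lra.
have alpha0 : 0 < alpha by lra.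
have al1_gt0 : 0 < 1 + alpha by lra.
have le1 : 1 <= 1 - gamma + 2 by lra.
have le2 : 1 <= 1 + alpha + delta by lra.
have eq3 : 1 + alpha + delta = 3 - gamma by lra.
have eq12 : 1 + (1 - gamma) = 2 - gamma by ring.
have eq13 : 1 + (2 - gamma) = 3 - gamma by ring.
have eq21 : 1 - gamma + 1 = 2 - gamma by ring.
have eq31 : 1 - gamma + 2 = 3 - gamma by ring.
(* v extended by 0 to the left of a *)
pose V s := v a * fker 1 (s - a) + w a * fker 2 (s - a) + conv 2 phi s.
have VE s : s < b -> V s = if gamma == 0 then y s else conv gamma y s.
  move=> sb; have [as_|sa] := ltP a s; last first.
    rewrite /V !fker_le0 ?subr_le0// (conv_left0 _ phi0 sa) (conv_left0 _ y0 sa).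
    by rewrite y0// !mulr0 !addr0 if_same.
  rewrite -vy ?as_// second_primitive ?(ltW as_) ?(ltW sb)// /V.
  by rewrite fker1E fker2E ?subr_ge0 ?(ltW as_)// subr_gt0 as_ mulr1.
have convV t : t <= b -> conv (1 - gamma) V t = conv 1 y t.
  move=> tb; move: VE; case: eqP => [gz VE|gz VE].
    rewrite gz subr0; apply: conv_eq => s st; apply: VE; exact: lt_le_trans tb.
  have gg : 0 < gamma by rewrite lt_neqAle gamma0 andbT eq_sym; apply/eqP.
  rewrite (@conv_eq _ _ _ (conv gamma y)).
    by have [_ ->] := semi_dom t g1_gt0 gg my yC; rewrite subrK.
  move=> s st; apply: VE; exact: lt_le_trans tb.
have r1P t : cintegrable 1 r1 t /\
    conv 1 r1 t = v a * fker (2 - gamma) (t - a) + w a * fker (3 - gamma) (t - a).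
  have [i1 e1] := fker_conv_shift a t (@ltr01 R) g1_gt0.
  have [i2 e2] := convZ (v a) i1.
  have [i3 e3] := fker_conv_shift a t (@ltr01 R) g2_gt0.
  have [i4 e4] := convZ (w a) i3.
  have [i5 e5] := convD i2 i4.
  by split; [exact: i5|rewrite e5 e2 e1 e4 e3 eq12 eq13].
have VP t : conv (1 - gamma) V t =
    v a * fker (2 - gamma) (t - a) + w a * fker (3 - gamma) (t - a) + conv (3 - gamma) phi t.
  have [i1 e1] := fker_conv_shift a t g1_gt0 (@ltr01 R).
  have [i2 e2] := convZ (v a) i1.
  have [i3 e3] := fker_conv_shift a t g1_gt0 (@ltr0Sn R 1).
  have [i4 e4] := convZ (w a) i3.
  have [i5 e5] := convD i2 i4.
  have [i6 e6] := semi_phi t g1_gt0 (@ltr0Sn R 1) le1.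
  have [_ e7] := convD i5 i6.
  by rewrite e7 e5 e2 e1 e4 e3 e6 eq21 eq31.
have key t : t <= b -> conv 1 y t = conv 1 (fun s => r1 s + conv alpha h s) t.
  move=> tb; rewrite -(convV t tb) VP; have [i1 e1] := r1P t.
  have [i2 e2] := semi_dom t (@ltr01 R) alpha0 mh hC.
  have [_ ->] := convD i1 i2; rewrite e1 e2.
  by rewrite -(phih al1_gt0 le2 tb) eq3.
have int t : cintegrable 1 (fun s => r1 s + conv alpha h s) t.
  have [i1 _] := r1P t.
  have [i2 _] := semi_dom t (@ltr01 R) alpha0 mh hC.
  by have [] := convD i1 i2.
have iy t := @cintegrable_dom _ 1 (1 - gamma) C a t y (@ltr01 R) g1_gt0 my yC.
have D t : cintegrable 1 (fun s => y s + (-1) * (r1 s + conv alpha h s)) t /\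
    conv 1 (fun s => y s + (-1) * (r1 s + conv alpha h s)) t =
    conv 1 y t - conv 1 (fun s => r1 s + conv alpha h s) t.
  have [i1 e1] := convZ (-1) (int t); have [i2 e2] := convD (iy t) i1.
  by split; [exact: i2|rewrite e2 e1 mulN1r].
have D0 t : t <= b -> conv 1 (fun s => y s + (-1) * (r1 s + conv alpha h s)) t = 0.
  by move=> tb; rewrite (D t).2 key// subrr.
apply: (@filterS _ _ (ae_filter_ringOfSetsType mu) _ _ _ (conv1_eq0_ae (D b).1 D0)).
by move=> t H tb; have := H tb; rewrite mulN1r => /eqP; rewrite subr_eq0 => /eqP.
Qed.

End IntegralEquation.

(** * The Green function *)

Section GreenFunction.
Context {R : realType}.
Notation mu := (@lebesgue_measure R).

Lemma Gamma_shift (x : R) : x < 1 -> Gamma (2 - x) = (1 - x) * Gamma (1 - x).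
Proof.
move=> x1; rewrite (_ : 2 - x = 1 - x + 1); last by ring.
by rewrite GammaS// subr_gt0.
Qed.

Lemma fker_first (x u : R) : x < 1 -> 0 < u -> fker (1 - x) u = u `^ (- x) * (1 - x) / Gamma (2 - x).
Proof.
move=> x1 u0; have x10 : 0 < 1 - x by rewrite subr_gt0.
rewrite (Gamma_shift x1) /fker (tpowE _ u0) (_ : 1 - x - 1 = - x); last by ring.
move: (Gamma_gt0 x10); move: (Gamma (1 - x)) => G G0.
by rewrite invfM -[in RHS]mulrA (mulrA (1 - x)) divff ?mul1r ?gt_eqF.
Qed.

Lemma fker_second (x u : R) : x < 1 -> 0 < u -> fker (2 - x) u = u `^ (- x) * u / Gamma (2 - x).
Proof.
move=> x1 u0; rewrite /fker (tpowE _ u0); congr (_ / _).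
rewrite -[X in _ * X](powRr1 (ltW u0)) -powRD; last by rewrite (gt_eqF u0) implybT.
by congr powR; ring.
Qed.

(** The estimate of the Green function rests on this: the difference of two
    nonnegative numbers is bounded by the larger one, not by the sum. *)
Lemma dist_le_max (A B L : R) : 0 <= A -> 0 <= B -> A <= L -> B <= L -> `|B - A| <= L.
Proof. by move=> A0 B0 AL BL; rewrite ler_norml; apply/andP; split; lra. Qed.

(** For s < t, alpha - 1 = (1 - gamma) - delta splits (b - s)^(alpha - 1) into
    (b - s)^(- delta) and a power of nonnegative exponent 1 - gamma, which with
    (t - a)^gamma makes up one power of b - a. *)
Lemma kernel_bound (a b gamma delta alpha t s : R) :
  0 <= gamma -> gamma < 1 -> 0 <= delta -> 1 < alpha -> gamma + delta = 2 - alpha ->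
  a < t < b -> a < s < b ->
  (t - a) `^ gamma * fker alpha (t - s) <= (b - s) `^ (- delta) * ((b - a) / Gamma alpha).
Proof.
move=> g0 g1 d0 al gd /andP[at_ tb] /andP[as_ sb].
have ab : a < b by exact: lt_trans tb.
have G0 : 0 < Gamma alpha by apply: Gamma_gt0; lra.
have [st|ts] := ltP s t; last first.
  rewrite fker_le0 ?subr_le0// mulr0 mulr_ge0 ?powR_ge0// divr_ge0 ?ltW//.
  by rewrite subr_gt0.
rewrite /fker tpowE ?subr_gt0// !mulrA ler_wpM2r ?invr_ge0 ?(ltW G0)//.
have e1 : (t - a) `^ gamma <= (b - a) `^ gamma.
  by apply: ge0_ler_powR => //; rewrite ?nnegrE; lra.
have e2 : (t - s) `^ (alpha - 1) <= (b - s) `^ (alpha - 1).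
  by apply: ge0_ler_powR => //; rewrite ?nnegrE; lra.
have e3 : (b - s) `^ (1 - gamma) <= (b - a) `^ (1 - gamma).
  by apply: ge0_ler_powR => //; rewrite ?nnegrE; lra.
have bs0 : 0 < b - s by rewrite subr_gt0.
have ba0 : 0 < b - a by rewrite subr_gt0.
have E1 : (b - s) `^ (alpha - 1) = (b - s) `^ (- delta) * (b - s) `^ (1 - gamma).
  rewrite -powRD; last by rewrite (gt_eqF bs0) implybT.
  by congr powR; lra.
have E2 : b - a = (b - a) `^ gamma * (b - a) `^ (1 - gamma).
  rewrite -powRD; last by rewrite (gt_eqF ba0) implybT.
  by rewrite addrCA subrr addr0 powRr1// ltW.
apply: (@le_trans _ _ ((b - a) `^ gamma * (b - s) `^ (alpha - 1))).
  by apply: ler_pM => //; exact: powR_ge0.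
rewrite E1 [X in _ <= _ * X]E2 mulrCA ler_wpM2l ?powR_ge0// ler_wpM2l ?powR_ge0//.
Qed.

(** The Green function of the problem for (t - a)^gamma y(t), as a kernel
    against h = - q y: the Cauchy kernel minus the correction which restores
    the boundary conditions. *)
Definition green (a b gamma delta alpha l m n p t s : R) : R :=
  (t - a) `^ gamma * fker alpha (t - s) -
  (m * (1 - gamma) + l * (t - a)) /
    ((m * n + l * p + l * n * (b - a)) * Gamma (2 - gamma)) *
  (n * fker (2 - delta) (b - s) + p * fker (1 - delta) (b - s)).

Definition green_Omega (a b gamma delta l m n p : R) : R :=
  ((l * (b - a) + m * (1 - gamma)) * (n * (b - a) + p * (1 - delta))) /
  ((m * n + l * p + l * n * (b - a)) * Gamma (2 - delta) * Gamma (2 - gamma)).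

(** The correction term, with T = t - a, S = b - s, B = b - a and with the
    values of Gamma and of the singular power P as parameters. *)
Lemma green_algebra (rho G1 G2 P l m n p g d T B S : R) :
  0 < rho -> 0 < G1 -> 0 < G2 -> 0 <= P ->
  0 <= l -> 0 <= m -> 0 <= n -> 0 <= p -> g <= 1 -> d <= 1 ->
  0 <= T <= B -> 0 <= S <= B ->
  let A := (m * (1 - g) + l * T) / (rho * G1) * (n * (P * S / G2) + p * (P * (1 - d) / G2)) in
  0 <= A /\ A <= ((l * B + m * (1 - g)) * (n * B + p * (1 - d))) / (rho * G2 * G1) * P.
Proof.
move=> rho0 G10 G20 P0 l0 m0 n0 p0 g1 d1 /andP[T0 TB] /andP[S0 SB] A.
have AE : A = (m * (1 - g) + l * T) * (n * S + p * (1 - d)) / (rho * G2 * G1) * P.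
  by rewrite /A; field; rewrite !gt_eqF.
have mg : 0 <= m * (1 - g) by rewrite mulr_ge0// subr_ge0.
have pd : 0 <= p * (1 - d) by rewrite mulr_ge0// subr_ge0.
have lT : 0 <= l * T by rewrite mulr_ge0.
have nS : 0 <= n * S by rewrite mulr_ge0.
have i0 : 0 <= (rho * G2 * G1)^-1 by rewrite invr_ge0 !mulr_ge0// ltW.
split; first by rewrite AE !mulr_ge0// addr_ge0.
rewrite AE; apply: ler_wpM2r => //; apply: ler_wpM2r => //.
apply: ler_pM; [exact: addr_ge0|exact: addr_ge0| |].
- by rewrite addrC lerD2r ler_wpM2l.
- by rewrite lerD2r ler_wpM2l.
Qed.

Lemma green_bound (a b gamma delta alpha l m n p t s : R) :
  0 <= gamma -> gamma < 1 -> 0 <= delta -> delta < 1 -> 1 < alpha ->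
  gamma + delta = 2 - alpha ->
  0 <= l -> 0 <= m -> 0 <= n -> 0 <= p -> 0 < m * n + l * p + l * n * (b - a) ->
  a < t < b -> a < s < b ->
  `|green a b gamma delta alpha l m n p t s| <=
  Num.max (green_Omega a b gamma delta l m n p) ((b - a) / Gamma alpha) *
  (b - s) `^ (- delta).
Proof.
move=> g0 g1 d0 d1 al gd l0 m0 n0 p0 rho0 tab sab.
have K := kernel_bound g0 g1 d0 al gd tab sab.
case/andP: tab => at_ tb; case/andP: sab => as_ sb.
have bs0 : 0 < b - s by rewrite subr_gt0.
have tab : 0 <= t - a <= b - a by rewrite subr_ge0 (ltW at_) lerD2r (ltW tb).
have sab : 0 <= b - s <= b - a by rewrite (ltW bs0) lerD2l lerN2 (ltW as_).
have g2 : 0 < 2 - gamma by rewrite subr_gt0 (lt_trans g1)// ltr1n.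
have d2 : 0 < 2 - delta by rewrite subr_gt0 (lt_trans d1)// ltr1n.
have al0 : 0 < alpha by exact: lt_trans al.
rewrite /green (fker_first d1 bs0) (fker_second d1 bs0).
have [A0 AO] := green_algebra rho0 (Gamma_gt0 g2) (Gamma_gt0 d2)
  (powR_ge0 (b - s) (- delta)) l0 m0 n0 p0 (ltW g1) (ltW d1) tab sab.
apply: (dist_le_max A0).
- exact: mulr_ge0 (powR_ge0 _ _) (fker_ge0 _ al0).
- by apply: le_trans AO _; apply: ler_wpM2r; [exact: powR_ge0|rewrite le_max lexx].
- apply: le_trans K _; rewrite mulrC; apply: ler_wpM2r; first exact: powR_ge0.
  by rewrite le_max lexx orbT.
Qed.

End GreenFunction.

Section GreenRepresentation.
Context {R : realType}.
Notation mu := (@lebesgue_measure R).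

(** The boundary conditions are two linear equations for c0 and c1 with
    determinant rho; this is Cramer's rule. *)
Lemma boundary_coefficients (l m n p L c0 c1 I1 I2 : R) :
  l * c0 - m * c1 = 0 -> n * (c0 + c1 * L + I2) + p * (c1 + I1) = 0 ->
  let rho := m * n + l * p + l * n * L in
  c0 * rho = - (m * (n * I2 + p * I1)) /\ c1 * rho = - (l * (n * I2 + p * I1)).
Proof.
move=> e1 e2 rho; have E : n * I2 + p * I1 = - (n * c0 + n * c1 * L + p * c1).
  by rewrite -[LHS](subr0) -e2; ring.
have e1' : l * c0 = m * c1 by move/eqP: e1; rewrite subr_eq0 => /eqP.
rewrite E /rho; split.
- rewrite (_ : c0 * _ = m * n * c0 + p * (l * c0) + n * L * (l * c0)); last by ring.
  by rewrite e1'; ring.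
- rewrite (_ : - (l * _) = n * (l * c0) + l * n * c1 * L + l * p * c1); last by ring.
  by rewrite e1'; ring.
Qed.

(** Insert the values of c0 and c1 into the integral equation.  The weight
    (t - a)^gamma cancels the singularity of the two homogeneous solutions,
    which leaves the factor m (1 - gamma) + l (t - a) of the Green function. *)
Lemma green_representation (a b gamma delta alpha l m n p c0 c1 t yt : R) (h : R -> R) :
  gamma < 1 -> a < t -> 0 < m * n + l * p + l * n * (b - a) ->
  cintegrable alpha h t -> cintegrable (2 - delta) h b -> cintegrable (1 - delta) h b ->
  l * c0 - m * c1 = 0 ->
  n * (c0 + c1 * (b - a) + conv (2 - delta) h b) + p * (c1 + conv (1 - delta) h b) = 0 ->
  yt = c0 * fker (1 - gamma) (t - a) + c1 * fker (2 - gamma) (t - a) + conv alpha h t ->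
  mu.-integrable [set: R] (fun s : R => (green a b gamma delta alpha l m n p t s * h s)%:E) /\
  (t - a) `^ gamma * yt = \int[mu]_s (green a b gamma delta alpha l m n p t s * h s).
Proof.
move=> g1 at_ rho0 ia i2 i1 bc1 bc2 yE.
have [C0 C1] := boundary_coefficients bc1 bc2.
set rho := m * n + _ + _ in rho0 C0 C1.
have ta0 : 0 < t - a by rewrite subr_gt0.
have g2 : 0 < 2 - gamma by rewrite subr_gt0 (lt_trans g1)// ltr1n.
pose A0 := (m * (1 - gamma) + l * (t - a)) / (rho * Gamma (2 - gamma)).
pose f1 (s : R) := fker alpha (t - s) * h s.
pose f2 (s : R) := fker (2 - delta) (b - s) * h s.
pose f3 (s : R) := fker (1 - delta) (b - s) * h s.
have if1 : mu.-integrable [set: R] (EFin \o f1) by exact: ia.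
have if2 : mu.-integrable [set: R] (EFin \o f2) by exact: i2.
have if3 : mu.-integrable [set: R] (EFin \o f3) by exact: i1.
have sc (c : R) (f : R -> R) : mu.-integrable [set: R] (EFin \o f) ->
    mu.-integrable [set: R] (EFin \o (fun s => c * f s)).
  by move=> fi; have := integrableZl measurableT c fi; apply: eq_integrable.
have ad (f g : R -> R) : mu.-integrable [set: R] (EFin \o f) ->
    mu.-integrable [set: R] (EFin \o g) ->
    mu.-integrable [set: R] (EFin \o (fun s => f s + g s)).
  by move=> fi gi; have := integrableD measurableT fi gi; apply: eq_integrable.
pose F (s : R) := (t - a) `^ gamma * f1 s + (- A0) * (n * f2 s + p * f3 s).
have iF23 := ad _ _ (sc n _ if2) (sc p _ if3).
have iF : mu.-integrable [set: R] (EFin \o F).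
  exact: ad _ _ (sc _ _ if1) (sc _ _ iF23).
have FE s : green a b gamma delta alpha l m n p t s * h s = F s.
  rewrite /green -/rho -/A0 /F /f1 /f2 /f3; generalize A0 => A1.
  move: (fker alpha _) (fker (2 - delta) _) (fker (1 - delta) _) (_ `^ _) => *; ring.
split; first by apply: eq_integrable iF => // s _; rewrite /= FE.
transitivity (\int[mu]_s F s); last by apply: eq_Rintegral => s _; rewrite FE.
rewrite /F RintegralD//; [|exact: sc _ _ if1|exact: sc _ _ iF23].
rewrite (RintegralZl _ measurableT if1) (RintegralZl _ measurableT iF23).
rewrite RintegralD; [|exact: measurableT|exact: sc _ _ if2|exact: sc _ _ if3].
rewrite (RintegralZl _ measurableT if2) (RintegralZl _ measurableT if3).
rewrite -[X in _ = _ * X + _]/(conv alpha h t).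
rewrite -[X in _ = _ + _ * (n * X + _)]/(conv (2 - delta) h b).
rewrite -[X in _ = _ + _ * (_ + p * X)]/(conv (1 - delta) h b).
rewrite yE mulrDr addrC; congr (_ + _).
rewrite fker_first// fker_second//.
set I2 := conv (2 - delta) h b in C0 C1 *; set I1 := conv (1 - delta) h b in C0 C1 *.
have P : (t - a) `^ gamma * (t - a) `^ (- gamma) = 1.
  by rewrite -powRD ?subrr ?powRr0// (gt_eqF ta0) implybT.
rewrite (_ : _ * (_ + _) = ((t - a) `^ gamma * (t - a) `^ (- gamma)) *
   ((c0 * (1 - gamma) + c1 * (t - a)) / Gamma (2 - gamma))); last by ring.
rewrite P mul1r /A0.
have G0 := Gamma_gt0 g2; move: (Gamma (2 - gamma)) G0 => G G0.
have c0E : c0 = - (m * (n * I2 + p * I1)) / rho by rewrite -C0 mulfK// gt_eqF.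
have c1E : c1 = - (l * (n * I2 + p * I1)) / rho by rewrite -C1 mulfK// gt_eqF.
rewrite c0E c1E; move: (n * I2 + p * I1) => K.
by field; rewrite !gt_eqF.
Qed.

End GreenRepresentation.

(** * The inequality *)

Section WeightedIntegral.
Context {R : realType}.
Notation mu := (@lebesgue_measure R).

Lemma fker_weight (x u : R) : x < 1 -> 0 < u -> u `^ (- x) = Gamma (1 - x) * fker (1 - x) u.
Proof.
move=> x1 u0; have G0 : 0 < Gamma (1 - x) by rewrite Gamma_gt0// subr_gt0.
rewrite /fker (tpowE _ u0) (_ : 1 - x - 1 = - x); last by ring.
by rewrite mulrC divfK// gt_eqF.
Qed.

(** The weight is a product of two kernels, integrable by [fker_conv_shift]. *)
Lemma integrable_weight (a b gamma delta : R) (q : R -> R) : a < b ->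
  gamma < 1 -> delta < 1 -> {within `[a, b], continuous q} ->
  mu.-integrable `]a, b[ (fun s : R =>
    ((s - a) `^ (- gamma) * (b - s) `^ (- delta) * `|q s|)%:E).
Proof.
move=> ab g1 d1 hq; have [Q Q0 HQ] := bounded_continuous (ltW ab) hq.
have g10 : 0 < 1 - gamma by rewrite subr_gt0.
have d10 : 0 < 1 - delta by rewrite subr_gt0.
have [i1 _] := fker_conv_shift a b d10 g10.
pose K (s : R) := Gamma (1 - gamma) * Gamma (1 - delta) * Q *
  (fker (1 - delta) (b - s) * fker (1 - gamma) (s - a)).
have iK : mu.-integrable [set: R] (EFin \o K).
  have := integrableZl measurableT (Gamma (1 - gamma) * Gamma (1 - delta) * Q) i1.
  by apply: eq_integrable => // s _; rewrite /= EFinM.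
have iKab : mu.-integrable `]a, b[ (EFin \o K) by exact: integrableS iK.
move: iKab; rewrite /K.
apply: le_integrable => //.
  apply/measurable_EFinP; apply: measurable_funM.
    apply: measurable_funM; apply: measurable_funTS;
      apply: (measurableT_comp (measurable_powR _)); exact: measurable_funB.
  apply: measurableT_comp => //; apply: subspace_continuous_measurable_fun => //.
  by apply: continuous_subspaceW hq; exact: subset_itv_oo_cc.
move=> s /=; rewrite in_itv/= => /andP[as_ sb].
rewrite lee_fin (fker_weight g1) ?subr_gt0// (fker_weight d1) ?subr_gt0//.
have G1 := ltW (Gamma_gt0 g10); have G2 := ltW (Gamma_gt0 d10).
have F1 := fker_ge0 (s - a) g10; have F2 := fker_ge0 (b - s) d10.
have q1 : `|q s| <= Q by apply: HQ; rewrite !ltW.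
move: (Gamma _) G1 (Gamma _) G2 (fker _ _) F1 (fker _ _) F2 => G1 G10 G2 G20 F1 F10 F2 F20.
have E : 0 <= G1 * F1 * (G2 * F2) by rewrite !mulr_ge0.
rewrite ger0_norm; last by rewrite mulr_ge0.
rewrite (_ : G1 * G2 * Q * (F2 * F1) = G1 * F1 * (G2 * F2) * Q); last by ring.
by apply: le_trans (ler_norm _); apply: ler_wpM2l.
Qed.

End WeightedIntegral.

Lemma window_nonempty (R : realType) (a b t d : R) : a < b -> a <= t <= b -> 0 < d ->
  Num.max a (t - d) < Num.min b (t + d).
Proof.
move=> ab /andP[at_ tb] d0; rewrite gt_max !lt_min.
by do ![apply/andP; split]; lra.
Qed.

Theorem theorem3p5 (R : realType) (a b alpha beta : R) (q : R -> R)
    (l m n p : R)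
    (hab : a < b) (halpha : 1 < alpha <= 2) (hbeta : 0 <= beta <= 1)
    (hq : {within `[a, b], continuous q})
    (hl : 0 <= l) (hm : 0 <= m) (hn : 0 <= n) (hp : 0 <= p)
    (hrho : 0 < m * n + l * p + l * n * (b - a)) :
  (exists y : R -> R,
     hilfer_bvp_solution a b alpha beta q l m n p y /\
     exists2 t : R, t \in `]a, b] & y t != 0) ->
  let Omega :=
    ((l * (b - a) + m * (alpha - 1 + beta * (2 - alpha))) *
     (n * (b - a) + p * (1 - 2 * beta + alpha * beta))) /
    ((m * n + l * p + l * n * (b - a)) *
     Gamma (2 - 2 * beta + alpha * beta) *
     Gamma (2 - (2 - alpha) * (1 - beta))) in
  let Lambda := Num.max Omega ((b - a) / Gamma alpha) in
  \int[@lebesgue_measure R]_(s in `]a, b[)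
    ((s - a) `^ ((alpha - 2) * (1 - beta)) *
     (b - s) `^ (beta * (alpha - 2)) * `|q s|) >= 1 / Lambda.
Proof.
move=> [y [[Cy ACv eqn bc1 bc2] [ty tyab yt0]]].
have [g0 d0 g1 d1 gd] := hilfer_orders halpha hbeta.
have al1 : 1 < alpha by case/andP: halpha.
pose gamma : R := (2 - alpha) * (1 - beta); pose delta : R := beta * (2 - alpha).
rewrite -/gamma -/delta in g0 d0 g1 d1 gd Cy ACv bc1 bc2 *.
have -> : alpha - 1 + beta * (2 - alpha) = 1 - gamma by rewrite /gamma; ring.
have -> : 1 - 2 * beta + alpha * beta = 1 - delta by rewrite /delta; ring.
have -> : 2 - 2 * beta + alpha * beta = 2 - delta by rewrite /delta; ring.
have -> : (alpha - 2) * (1 - beta) = - gamma by rewrite /gamma; ring.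
have -> : beta * (alpha - 2) = - delta by rewrite /delta; ring.
(* The local definitions sit inside the coerced boolean. *)
cbv zeta; set Lambda := Num.max _ _.
have al0 : 0 < alpha by exact: lt_trans al1.
have g10 : 0 < 1 - gamma by rewrite subr_gt0.
have d10 : 0 < 1 - delta by rewrite subr_gt0.
have d20 : 0 < 2 - delta by rewrite subr_gt0 (lt_trans d1)// ltr1n.
have L0 : 0 < Lambda.
  by rewrite lt_max; apply/orP; right; apply: divr_gt0; [rewrite subr_gt0|exact: Gamma_gt0].
pose k (s : R) := (s - a) `^ (- gamma) * (b - s) `^ (- delta) * `|q s|.
have ik : (@lebesgue_measure R).-integrable `]a, b[ (EFin \o k).
  exact: integrable_weight.
set J := Rintegral _ _ _.
have [t0 t0ab HX] := weighted_max hab Cy.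
set X := extend_left a _ in HX.
set M := `|X t0| in HX.
have M0 : 0 < M.
  move: tyab; rewrite in_itv/= => /andP[aty tyb].
  apply: lt_le_trans (HX ty _); last by rewrite (ltW aty).
  by rewrite normr_gt0 /X extend_left_gt// mulf_neq0// gt_eqF// powR_gt0// subr_gt0.
pose y_ := y \_ `]a, b[.
pose h_ := (fun t => - (q t * y t)) \_ `]a, b[.
have my : measurable_fun [set: R] y_ by exact: (measurable_weighted Cy).
have yM s := weighted_bound hab g1 HX s.
have [C2 C20 [mh hC2]] := weighted_source_bound hab halpha hbeta hq Cy.
have G1 := Gamma_gt0 g10.
pose C := M * Gamma (1 - gamma) + C2.
have C1C : M * Gamma (1 - gamma) <= C by rewrite lerDl.
have C2C : C2 <= C by rewrite lerDr mulr_ge0// ltW.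
have yC s : `|y_ s| <= C * fker (1 - gamma) (s - a).
  by apply: le_trans (yM s) _; rewrite ler_wpM2r ?fker_ge0.
have hC s : `|h_ s| <= C * fker (1 - gamma) (s - a).
  by apply: le_trans (hC2 s) _; rewrite ler_wpM2r ?fker_ge0.
have [phi [iphi phi0 wE phih]] := bvp_density hab halpha hbeta ACv eqn.
set v := extend_left a (RLint a gamma y) in bc1 bc2 wE.
have [dv cw _] := ACv.
have vw t : a <= t <= b -> v t - v a = \int[@lebesgue_measure R]_(s in `]a, t[) derive_on a b v s.
  by move=> tab; apply: FTC_derive_on.
have vy t : a < t < b -> v t = if gamma == 0 then y_ t else conv gamma y_ t.
  move=> /andP[at_ tb]; rewrite /v extend_left_gt//; case: eqP => [gz|/eqP gz].
    by rewrite /RLint gz eqxx /y_ patchE mem_set//= in_itv/= at_.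
  by rewrite (RLint_conv _ at_ (ltW tb) my)// lt_neqAle eq_sym gz.
have IE := integral_equation g0 g1 d0 d1 al1 gd my mh yC hC iphi phi0 wE phih vw vy.
have Bv := boundary_v hab d1 iphi phi0 wE phih vw.
have Bw := boundary_w hab d1 wE phih.
rewrite Bv Bw in bc2.
pose kr (s : R) := (k \_ `]a, b[) s.
have ikr : (@lebesgue_measure R).-integrable [set: R] (EFin \o kr).
  rewrite /kr -restrict_EFin; apply/(integrable_mkcond _ _).1 => //.
have JE : J = \int[@lebesgue_measure R]_s kr s by rewrite /J Rintegral_mkcond.
(* The integrand is at most Lambda M times the weight. *)
have main : {ae @lebesgue_measure R, forall t, a < t < b -> `|X t| <= Lambda * M * J}.
  apply: (@filterS _ _ (ae_filter_ringOfSetsType _) _ _ _ IE) => t H /andP[at_ tb].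
  have yE := H tb.
  have ytE : y_ t = y t by rewrite /y_ patchE mem_set//= in_itv/= at_.
  rewrite ytE in yE.
  have ia := @cintegrable_dom _ alpha (1 - gamma) C a t h_ al0 g10 mh hC.
  have i2 := @cintegrable_dom _ (2 - delta) (1 - gamma) C a b h_ d20 g10 mh hC.
  have i1 := @cintegrable_dom _ (1 - delta) (1 - gamma) C a b h_ d10 g10 mh hC.
  have [iG XE] := green_representation g1 at_ hrho ia i2 i1 bc1 bc2 yE.
  rewrite /X extend_left_gt// XE.
  apply: le_trans (le_normr_Rintegral measurableT iG) _.
  rewrite JE -(RintegralZl _ measurableT ikr).
  apply: le_Rintegral.
  - exact: measurableT.
  - exact: integrable_norm iG.
  - have := integrableZl measurableT (Lambda * M) ikr.
    by apply: eq_integrable.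
  move=> s _; have [sab|sab] := boolP (a < s < b); last first.
    have -> : h_ s = 0 by rewrite /h_ patchE mem_setE in_itv/= (negbTE sab).
    by rewrite mulr0 normr0 /kr patchE mem_setE in_itv/= (negbTE sab) mulr0.
  have -> : kr s = k s by rewrite /kr patchE mem_set//= in_itv.
  have -> : h_ s = - (q s * y s) by rewrite /h_ patchE mem_set//= in_itv.
  have tab : a < t < b by rewrite at_.
  have GB := green_bound g0 g1 d0 d1 al1 gd hl hm hn hp hrho tab sab.
  case/andP: sab => as_ sb.
  have yB : `|y s| <= M * (s - a) `^ (- gamma).
    rewrite (weightedK gamma y as_) normrM (ger0_norm (powR_ge0 _ _)) mulrC.
    apply: ler_wpM2r; first exact: powR_ge0.
    by apply: HX; rewrite !ltW.
  rewrite normrM normrN normrM.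
  apply: (@le_trans _ _ ((Lambda * (b - s) `^ (- delta)) * (`|q s| * (M * (s - a) `^ (- gamma))))).
    by apply: ler_pM; [exact: normr_ge0|rewrite mulr_ge0|exact: GB|apply: ler_wpM2l].
  rewrite le_eqVlt; apply/orP; left; apply/eqP; rewrite /k.
  move: (_ `^ _) (_ `^ _) => P1 P2; ring.
rewrite ler_pdivrMr// leNgt; apply/negP => JL.
have LMJ : Lambda * M * J < M.
  by rewrite mulrAC -[ltRHS]mul1r ltr_pM2r// mulrC.
have cX : {within `[a, b], continuous (fun t => `|X t|)}.
  by move=> t; apply: (@cvg_norm R R^o); exact: Cy.
(* If Lambda J < 1, then |X| > Lambda M J on a whole neighbourhood of t0. *)
have e0 : 0 < M - Lambda * M * J by rewrite subr_gt0.
have := cX t0; rewrite /continuous_at => /cvgrPdist_lt/(_ _ e0).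
have t0in : `[a, b]%classic t0 by rewrite /= in_itv.
case: (@nbhs_subspaceP _ `[a, b]%classic t0) => // _ [d /= dpos Hd].
have cd := window_nonempty hab t0ab dpos.
have [s + /= Hs] := ae_exists_itv cd main.
rewrite gt_max lt_min => /andP[/andP[as_ sd1] /andP[sb sd2]].
have /Hs h1 : a < s < b by rewrite as_.
have h2 : `|M - `|X s| | < M - Lambda * M * J.
  apply: Hd; last by rewrite /= in_itv/= !ltW.
  by rewrite /ball_/= ltr_distlC sd1 sd2.
have := le_lt_trans (ler_norm _) h2; rewrite ltrD2l ltrN2.
by rewrite ltNge h1.
Qed.
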